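(* Let $k$ be a field, $S=k[x_1,\ldots,x_n]$, and let $M$ be a finitely generated graded $S$-module. Let $0\to F_s\to\cdots\to F_1\to F_0\to M\to 0$ be a minimal graded free resolution of $M$ over $S$, and let $b_i$ be the maximum degree of the generators of $F_i$. Then for every integer $t$ with $0\le t\le\dim M$: (i) $\mathrm{reg}_t(M)=\max\{b_i-i\mid i\ge n-t\}$; (ii) $a^*_t(M)=\max\{b_i\mid i\ge n-t\}-n$.
   Context: $S$ has the standard grading and $\mathfrak M=(x_1,\ldots,x_n)$. $H^i_{\mathfrak M}(M)$ is the $i$-th local cohomology module of $M$ with respect to $\mathfrak M$, $a_i(M)=\max\{m\mid H^i_{\mathfrak M}(M)_m\ne 0\}$ with $a_i(M)=-\infty$ if $H^i_{\mathfrak M}(M)=0$, $\mathrm{reg}_t(M)=\max\{a_i(M)+i\mid 0\le i\le t\}$ and $a^*_t(M)=\max\{a_i(M)\mid 0\le i\le t\}$. Convention: $b_i=-\infty$ if $F_i=0$ (in particular for $i>s$). *)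

(* Defs.v *)
From HB Require Import structures.
(* [mpoly] has to be imported before [constructive_ereal], otherwise their
   notations at level 2 conflict. *)
From mathcomp Require Import all_boot all_order all_algebra.
From mathcomp Require Import mpoly.
From mathcomp Require Import boolp constructive_ereal.

Set Implicit Arguments.
Unset Strict Implicit.
Unset Printing Implicit Defensive.

Import Order.TTheory GRing.Theory Num.Theory.
Local Open Scope ring_scope.

(* Maximum of a set of integers: -oo on the empty set, +oo on a set that is not
   bounded above. *)
Definition zmax (P : int -> Prop) : \bar int :=
  if pselect (exists m, P m /\ forall j, P j -> j <= m) is left e
  then (projT1 (cid e))%:E
  else if `[< exists m, P m >] then +oo%E else -oo%E.

(* Z-graded modules over k[x_1, ..., x_n] with its standard grading; [gr_comp d]
   is the homogeneous component of degree d, and the last two fields say that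
   the module is the direct sum of these components. *)
Record gradedModule (k : fieldType) (n : nat) := GradedModule {
  gm_sort :> lmodType {mpoly k[n]};
  gr_comp : int -> gm_sort -> Prop;
  gr_comp0 : forall d, gr_comp d 0;
  gr_compB : forall d u v, gr_comp d u -> gr_comp d v -> gr_comp d (u - v);
  gr_compZ : forall (e : nat) (d : int) (p : {mpoly k[n]}) v,
    p \is e.-homog for mdeg -> gr_comp d v -> gr_comp (e%:Z + d) (p *: v);
  gr_comp_span : forall v, exists (s : seq int) (f : int -> gm_sort),
    (forall d, gr_comp d (f d)) /\ v = \sum_(d <- s) f d;
  gr_comp_direct : forall (s : seq int) (f : int -> gm_sort), uniq s ->
    (forall d, gr_comp d (f d)) -> \sum_(d <- s) f d = 0 ->
    forall d, d \in s -> f d = 0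
}.

Section GradedModules.
Variables (k : fieldType) (n : nat).
Local Notation S := {mpoly k[n]}.
Local Notation gmod := (gradedModule k n).

Definition degree0 (A B : gmod) (f : A -> B) : Prop :=
  forall d v, gr_comp d v -> gr_comp d (f v).

Definition finitely_generated (M : gmod) : Prop :=
  exists (r : nat) (g : 'I_r -> M),
    forall v, exists c : 'I_r -> S, v = \sum_j c j *: g j.

(* The powers of the ideal (x_1, ..., x_n), by (x)^(e+1) = (x) (x)^e. *)
Fixpoint irrelevant_pow (e : nat) (p : S) : Prop :=
  if e is e'.+1 then
    exists q : 'I_n -> S,
      (forall i, irrelevant_pow e' (q i)) /\ p = \sum_i 'X_i * q i
  else True.

(* Membership in the submodule (x_1, ..., x_n) N. *)
Definition in_irrelevant_mul (N : gmod) (v : N) : Prop :=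
  exists w : 'I_n -> N, v = \sum_i ('X_i : S) *: w i.

(* Membership in Gamma_(x_1, ..., x_n) (N). *)
Definition in_torsion (N : gmod) (v : N) : Prop :=
  exists e : nat, forall p : S, irrelevant_pow e p -> p *: v = 0.

(* [idealr_closed] includes that 1 is not in the ideal. *)
Definition prime_chain_above_ann (M : gmod) (l : nat) : Prop :=
  exists P : nat -> {pred S},
    [/\ forall i, (i <= l)%N -> idealr_closed (P i) /\ prime_idealr_closed (P i),
        forall a, (forall v : M, a *: v = 0) -> a \in P 0%N
      & forall i, (i < l)%N ->
          {subset P i <= P i.+1} /\ exists a, a \in P i.+1 /\ a \notin P i].

(* dim M = dim (S / Ann M), with dim 0 = -oo. *)
Definition krull_dim (M : gmod) : \bar int :=
  zmax (fun m => exists l : nat, m = l%:Z /\ prime_chain_above_ann M l).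

(* A finite homogeneous basis, i.e. an isomorphism of F with the direct sum of
   the shifted modules S(- basis_deg j). *)
Record homog_basis (F : gmod) := HomogBasis {
  basis_rank : nat;
  basis_elt : 'I_basis_rank -> F;
  basis_deg : 'I_basis_rank -> int;
  basis_homog : forall j, gr_comp (basis_deg j) (basis_elt j);
  basis_unique : forall v, exists! c : 'rV[S]_basis_rank,
    v = \sum_j c 0 j *: basis_elt j
}.

Record minimal_free_resolution (M : gmod) (s : nat) := MinimalFreeResolution {
  free_term : nat -> gmod;
  free_basis : forall i, homog_basis (free_term i);
  free_aug : {linear free_term 0%N -> M};
  free_diff : forall i, {linear free_term i.+1 -> free_term i};
  free_aug_degree0 : degree0 free_aug;
  free_diff_degree0 : forall i, degree0 (free_diff i);
  free_aug_surj : forall v, exists w, free_aug w = v;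
  free_exact0 : forall v, free_aug v = 0 <-> exists w, free_diff 0%N w = v;
  free_exactS : forall i v,
    free_diff i v = 0 <-> exists w, free_diff i.+1 w = v;
  free_length : forall i, (s < i)%N -> forall v : free_term i, v = 0;
  free_minimal : forall i v, in_irrelevant_mul (free_diff i v)
}.

Definition max_gen_degree (M : gmod) (s : nat)
    (F : minimal_free_resolution M s) (i : nat) : \bar int :=
  zmax (fun m =>
    exists j : 'I_(basis_rank (free_basis F i)), basis_deg j = m).

(* Injective objects of the category of graded modules and maps of degree 0. *)
Definition graded_injective (I : gmod) : Prop :=
  forall (A B : gmod) (u : {linear A -> B}) (f : {linear A -> I}),
    degree0 u -> injective u -> degree0 f ->
    exists g : {linear B -> I}, degree0 g /\ forall a, g (u a) = f a.

Record injective_resolution (M : gmod) := InjectiveResolution {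
  inj_term : nat -> gmod;
  inj_coaug : {linear M -> inj_term 0%N};
  inj_diff : forall i, {linear inj_term i -> inj_term i.+1};
  inj_injective : forall i, graded_injective (inj_term i);
  inj_coaug_degree0 : degree0 inj_coaug;
  inj_diff_degree0 : forall i, degree0 (inj_diff i);
  inj_coaug_inj : injective inj_coaug;
  inj_exact0 : forall v, inj_diff 0%N v = 0 <-> exists w, inj_coaug w = v;
  inj_exactS : forall i v,
    inj_diff i.+1 v = 0 <-> exists w, inj_diff i w = v
}.

(* Local cohomology is the right derived functor of Gamma on graded modules:
   the i-th one is the i-th cohomology of Gamma (inj_term I _), whose component
   of degree m is the quotient of cocycles by coboundaries below. *)
Section LocalCohomology.
Variables (M : gmod) (I : injective_resolution M).

Definition lc_cocycle (i : nat) (m : int) (z : inj_term I i) : Prop :=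
  [/\ gr_comp m z, in_torsion z & inj_diff I i z = 0].

Definition lc_coboundary (i : nat) (m : int) : inj_term I i -> Prop :=
  match i with
  | 0%N => fun z => z = 0
  | i'.+1 => fun z =>
      exists y, [/\ gr_comp m y, in_torsion y & inj_diff I i' y = z]
  end.

Definition local_cohomology_neq0 (i : nat) (m : int) : Prop :=
  exists z, lc_cocycle m z /\ ~ @lc_coboundary i m z.

Definition a_inv (i : nat) : \bar int := zmax (local_cohomology_neq0 i).

Definition reg_upto (t : nat) : \bar int :=
  (\big[maxe/-oo]_(i < t.+1) (a_inv i + i%:Z%:E))%E.

Definition astar_upto (t : nat) : \bar int :=
  (\big[maxe/-oo]_(i < t.+1) a_inv i)%E.

End LocalCohomology.

End GradedModules.

(* Main.v *)
From HB Require Import structures.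
Require Import Defs.
From mathcomp Require Import all_boot all_order all_algebra.
From mathcomp Require Import mpoly.
From mathcomp Require Import boolp constructive_ereal.
From mathcomp Require Import zify ring.

Set Implicit Arguments.
Unset Strict Implicit.
Unset Printing Implicit Defensive.

Import Order.TTheory GRing.Theory Num.Theory.
Local Open Scope ring_scope.

(* The composite F -> M -> I is bijective on homology. For J_r the ideal
   (x_1^e, ..., x_r^e) there is a chain map F_i / J_r F_i -> I^(r-i)[J_r], of
   degree -re, which is bijective on homology. It is built by induction on r:
   x_(r+1)^e is regular modulo J_r on F and surjective on the J_r-torsion
   I[J_r], because graded injectives are coregular, and the next map is the
   connecting homomorphism. For r = n this identifies H^j(I[J_n]) in degree d
   with the homology of F / J_n F in position n - j and degree d + ne. Since
   S / J_n lives in degrees at most n(e-1), local cohomology H^j can be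
   nonzero in degree d only if F_(n-j) has a generator of degree at least d +
   n. Conversely let g be a generator of F_i such that no generator of
   F_(i+1) has larger degree. By minimality the coefficient of g in every
   boundary vanishes and the boundary of g lies in the irrelevant ideal, so
   the socle element (x_1 ... x_n)^(e-1) g is a cycle modulo J_n and not a
   boundary. These classes correspond to each other when e varies, and give a
   nonzero element of H^(n-i) in degree deg g - n. *)

(** * Differential modules *)

Definition submodule (R : nzRingType) (V : lmodType R) (P : V -> Prop) :=
  P 0 /\ forall a u v, P u -> P v -> P (a *: u + v).

Section Submodule.
Variables (R : nzRingType) (V : lmodType R) (P : V -> Prop).
Hypothesis subP : submodule P.

Lemma submod0 : P 0. Proof. by case: subP. Qed.

Lemma submodZ a u : P u -> P (a *: u).
Proof. by move=> Pu; rewrite -[_ *: _]addr0;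
  apply: (proj2 subP) Pu submod0. Qed.

Lemma submodD u v : P u -> P v -> P (u + v).
Proof. by move=> Pu Pv; rewrite -[u]scale1r; apply: (proj2 subP). Qed.

Lemma submodN u : P u -> P (- u).
Proof. by rewrite -scaleN1r; apply: submodZ. Qed.

Lemma submodB u v : P u -> P v -> P (u - v).
Proof. by move=> Pu Pv; apply: submodD => //; apply: submodN. Qed.

Lemma submod_sum (J : Type) (r : seq J) (Q : pred J) (f : J -> V) :
  (forall j, Q j -> P (f j)) -> P (\sum_(j <- r | Q j) f j).
Proof. by move=> Pf; apply: (big_ind P) => //;
  [exact: submod0 | exact: submodD]. Qed.

End Submodule.

Section DifferentialModules.
Variables (R : comNzRingType) (V W : lmodType R).
Variables (D : {linear V -> V}) (E : {linear W -> W}).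

(* Injectivity and surjectivity on homology of V / JV -> WJ. *)
Definition homology_bij (JV : V -> Prop) (WJ : W -> Prop) (phi : V -> W) :=
  (forall v y, JV (D v) -> WJ y -> phi v = E y ->
     exists g h, JV h /\ v = D g + h) /\
  (forall z, WJ z -> E z = 0 ->
     exists v y, [/\ JV (D v), WJ y & z = phi v + E y]).

(** When [w] lifts a map [phi] through multiplication by [x] and [phi] commutes with the
    differentials up to the sign [s], this failure of [w] to do the same is killed by [x]. *)
Definition connecting_map (s : R) (w : {linear V -> W}) (v : V) : W :=
  E (w v) - s *: w (D v).

Lemma connecting_map_is_linear s w : linear (connecting_map s w).
Proof.
move=> a u v; rewrite /connecting_map (linearP D) !(linearP w) (linearP E).
by rewrite scalerDr opprD scalerBr !scalerA [s * a]mulrC addrACA.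
Qed.

HB.instance Definition _ s w :=
  GRing.isLinear.Build R V W _ (connecting_map s w) (connecting_map_is_linear s
    w).

Hypothesis DD : forall v, D (D v) = 0.
Hypothesis EE : forall z, E (E z) = 0.

(** Both sides reduce to [- s *: E (w (D v))] by [DD] and [EE]. The sign thus alternates from one
    connecting map to the next. *)
Lemma connecting_map_anticomm s w v :
  E (connecting_map s w v) = - s *: connecting_map s w (D v).
Proof.
rewrite /connecting_map linearB linearZ /= EE DD linear0 scaler0 sub0r subr0.
by rewrite scaleNr.
Qed.

Variables (x s : R) (JV JV' : V -> Prop) (WJ WJ' : W -> Prop).
Variables phi w : {linear V -> W}.
Hypothesis ss : s * s = 1.
Hypotheses (subJ : submodule JV) (subW : submodule WJ).
Hypothesis DJ : forall v, JV v -> JV (D v).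
Hypothesis EW : forall z, WJ z -> WJ (E z).
Hypothesis JV'E : forall v, JV' v <-> exists g h, JV h /\ v = x *: g + h.
Hypothesis WJ'E : forall z, WJ' z <-> WJ z /\ x *: z = 0.
Hypothesis regx : forall v, JV (x *: v) -> JV v.
Hypothesis coregx : forall u, WJ u -> exists y, WJ y /\ x *: y = u.
Hypothesis phiW : forall v, WJ (phi v).
Hypothesis phiJ : forall v, JV v -> phi v = 0.
Hypothesis wW : forall v, WJ (w v).
Hypothesis wJ : forall v, JV v -> w v = 0.
Hypothesis xw : forall v, x *: w v = phi v.
Hypothesis Ephi : forall v, E (phi v) = s *: phi (D v).

(* connecting_map s w is the connecting map of multiplication by x, from V / x V
   to the x-torsion of W, and the claim is the five lemma. *)
Lemma connecting_map_homology_bij :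
  homology_bij JV WJ phi -> homology_bij JV' WJ' (connecting_map s w).
Proof.
have ssZ (U : lmodType R) (u : U) : s *: (s *: u) = u.
  by rewrite scalerA ss scale1r.
move=> [inj surj]; split.
- move=> f y /JV'E [g [h [Jh Df]]] /WJ'E [Wy xy] psif.
  (* Since [w (x *: g) = phi g], the relation [psif] reads E(w f) - s phi(g) = E y. Hence phi(g) is
     a boundary and [inj] applies to g. *)
  have phig : phi g = E (s *: (w f - y)).
    rewrite (linearZZ E) (linearB E) -psif /connecting_map Df (linearD w)
      (linearZZ w).
    by rewrite /= xw (wJ Jh) addr0 opprB addrCA subrr addr0 ssZ.
  have JDg : JV (D g).
    apply: regx; rewrite -linearZZ.
    have -> : x *: g = D f - h by rewrite Df addrK.
    by rewrite (linearB D) DD sub0r; apply: submodN => //; apply: DJ.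
  have WW v : WJ (w v - y) by apply: submodB.
  have [a [h2 [Jh2 gE]]] := inj _ _ JDg (submodZ subW s (WW f)) phig.
  (* Subtracting phi(a) turns w f - y into a cocycle, which [surj] writes as phi(b) + E c. *)
  have Ez : E (w f - y - phi a) = 0.
    rewrite (linearB E) Ephi.
    have -> : phi (D a) = phi g by rewrite gE (linearD phi) (phiJ Jh2) addr0.
    by rewrite phig (linearZZ E) ssZ subrr.
  have [b [c [JDb Wc eqz]]] := surj _ (submodB subW (WW f) (phiW a)) Ez.
  (* Multiplying [eqz] by x removes y and turns w f into phi(f), so [inj] applies a second time, now
     to f - x (a + b). *)
  have phif : phi (f - x *: (a + b)) = E (x *: c).
    rewrite (linearB phi) (linearZZ phi) (linearD phi) scalerDr (linearZZ E).
    have := congr1 (fun z => x *: z) eqz.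
    rewrite /= !scalerBr xw xy subr0 scalerDr => e.
    by rewrite opprD addrA e addrAC subrr add0r.
  have JDf : JV (D (f - x *: (a + b))).
    rewrite (linearB D) (linearZZ D) (linearD D) Df gE !scalerDr.
    rewrite -[x *: D a + _ + _]addrA [x *: D a + _]addrC opprD addrA addrK.
    by apply: submodB => //; first (apply: submodD => //); apply: submodZ.
  have [p [q [Jq fE]]] := inj _ _ JDf (submodZ subW x Wc) phif.
  exists p, (x *: (a + b) + q); split; first by apply/JV'E; exists (a + b), q.
  by rewrite addrCA -fE addrCA subrr addr0.
- move=> z /WJ'E [Wz xz] Ez.
  have [f [y [JDf Wy zE]]] := surj _ Wz Ez.
  (* From x z = 0 it follows that phi(x f) is a boundary, so [inj] gives x f = D g + h. *)
  have xzE : phi (x *: f) + x *: E y = 0.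
    by rewrite (linearZZ phi) -scalerDr -zE.
  have JDxf : JV (D (x *: f)) by rewrite linearZZ; apply: submodZ.
  have [|g [h [Jh xfE]]] := inj _ _ JDxf (submodZ subW (- x) Wy).
    by rewrite (linearZZ E) scaleNr; apply/eqP; rewrite -addr_eq0 xzE.
  (* This element is a cocycle. Writing it as phi(g2) + E y2 with y2 = x y3 shows how to correct g
     and y so that the new y is killed by x. *)
  have Wc : WJ (s *: phi g + x *: y).
    by apply: submodD => //; apply: submodZ.
  have Ec : E (s *: phi g + x *: y) = 0.
    rewrite (linearD E) !(linearZZ E) Ephi ssZ -xzE xfE (linearD phi) (phiJ Jh).
    by rewrite addr0.
  have [g2 [y2 [JDg2 Wy2 cE]]] := surj _ Wc Ec.
  have [y3 [Wy3 xy3]] := coregx Wy2.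
  pose g1 := g - s *: g2.
  have xy' : x *: (s *: w g1 + y - E y3) = 0.
    rewrite scalerBr -(linearZZ E) xy3 scalerDr scalerA [x * s]mulrC -scalerA
      xw.
    rewrite /g1 (linearB phi) (linearZZ phi) scalerBr ssZ.
    by rewrite [_ - phi g2 + _]addrAC cE [phi g2 + _]addrC addrK subrr.
  (* Modulo [JV] the elements D g1 and x f agree, so w (D g1) = phi(f). The two terms containing E
     (w g1) then cancel, leaving phi(f) + E y = z. *)
  exists (- s *: g1), (s *: w g1 + y - E y3); split.
  + apply/JV'E; exists (- s *: f), (s *: (h + s *: D g2)); split.
      apply: submodZ => //; apply: submodD => //; exact: submodZ.
    have -> : s *: (h + s *: D g2) = - s *: - (h + s *: D g2).
      by rewrite scaleNr scalerN opprK.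
    rewrite scalerA [x * _]mulrC -scalerA -scalerDr (linearZZ D) xfE /g1.
    by rewrite (linearB D) (linearZZ D) opprD addrA addrK.
  + apply/WJ'E; split=> //; apply: submodB => //; last exact: EW.
    by apply: submodD => //; apply: submodZ.
  + have wDg1 : w (D g1) = phi f.
      rewrite /g1 (linearB D) (linearZZ D).
      have -> : D g = x *: f - h by rewrite xfE addrK.
      rewrite !(linearB w) !(linearZZ w) xw (wJ Jh) (wJ JDg2).
      by rewrite scaler0 !subr0.
    rewrite (linearZZ (connecting_map s w)) /= /connecting_map wDg1 zE.
    rewrite (linearB E) EE subr0 (linearD E) (linearZZ E) scalerBr scalerA.
    rewrite mulNr ss !scaleNr scale1r opprK [RHS]addrA; congr (_ + _).
    by rewrite addrAC addNr add0r.
Qed.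

End DifferentialModules.

(** * Product modules and bases *)

(** A whole complex is stored as one module with one endomorphism, [lower] or [raise], so that a map
    of complexes is a single linear map and may change positions freely. *)
Definition product_module (R : nzRingType) (T : nat -> lmodType R) :=
  forall i, T i.

Section ProductModule.
Variables (R : nzRingType) (T : nat -> lmodType R).
Local Notation P := (product_module T).

HB.instance Definition _ := gen_eqMixin P.
HB.instance Definition _ := gen_choiceMixin P.

Lemma product_moduleP (u v : P) : (forall i, u i = v i) -> u = v.
Proof. by move=> e; apply: functional_extensionality_dep. Qed.

Definition prodmod0 : P := fun i => 0.
Definition prodmod_opp (u : P) : P := fun i => - u i.
Definition prodmod_add (u v : P) : P := fun i => u i + v i.
Definition prodmod_scale (a : R) (u : P) : P := fun i => a *: u i.

Lemma prodmod_addA : associative prodmod_add.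
Proof. by move=> u v w; apply: product_moduleP => i; exact: addrA. Qed.

Lemma prodmod_addC : commutative prodmod_add.
Proof. by move=> u v; apply: product_moduleP => i; exact: addrC. Qed.

Lemma prodmod_add0 : left_id prodmod0 prodmod_add.
Proof. by move=> u; apply: product_moduleP => i; exact: add0r. Qed.

Lemma prodmod_addN : left_inverse prodmod0 prodmod_opp prodmod_add.
Proof. by move=> u; apply: product_moduleP => i; exact: addNr. Qed.

HB.instance Definition _ := GRing.isZmodule.Build P
  prodmod_addA prodmod_addC prodmod_add0 prodmod_addN.

Lemma prodmod_scaleA a b u :
  prodmod_scale a (prodmod_scale b u) = prodmod_scale (a * b) u.
Proof. by apply: product_moduleP => i; exact: scalerA. Qed.

Lemma prodmod_scale1 : left_id 1 prodmod_scale.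
Proof. by move=> u; apply: product_moduleP => i; exact: scale1r. Qed.

Lemma prodmod_scaleDr : right_distributive prodmod_scale +%R.
Proof. by move=> a u v; apply: product_moduleP => i; exact: scalerDr. Qed.

Lemma prodmod_scaleDl u :
  {morph (fun a => prodmod_scale a u) : a b / a + b >-> a + b}.
Proof. by move=> a b; apply: product_moduleP => i; exact: scalerDl. Qed.

HB.instance Definition _ := GRing.Zmodule_isLmodule.Build R P
  prodmod_scaleA prodmod_scale1 prodmod_scaleDr prodmod_scaleDl.

Lemma prodmodDE (u v : P) i : (u + v) i = u i + v i. Proof. by []. Qed.
Lemma prodmodNE (u : P) i : (- u) i = - u i. Proof. by []. Qed.
Lemma prodmodZE a (u : P) i : (a *: u) i = a *: u i. Proof. by []. Qed.

Lemma prodmod_sumE (J : Type) (r : seq J) (Q : pred J) (f : J -> P) i :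
  (\sum_(j <- r | Q j) f j) i = \sum_(j <- r | Q j) f j i.
Proof. by elim/big_rec2: _ => // j y x _ <-. Qed.

Definition prodmod_single i (u : T i) : P := dfwith (0 : P) u.

Lemma single_in i (u : T i) : prodmod_single u i = u.
Proof. exact: dfwith_in. Qed.

Lemma single_out i (u : T i) j : i != j -> prodmod_single u j = 0.
Proof. exact: dfwith_out. Qed.

Lemma single_is_linear i : linear (@prodmod_single i).
Proof.
move=> a u v; apply: product_moduleP => j.
rewrite prodmodDE prodmodZE; have [<-|neq] := eqVneq i j.
  by rewrite !single_in.
by rewrite !single_out // scaler0 addr0.
Qed.

HB.instance Definition _ i :=
  GRing.isLinear.Build R (T i) P _ (@prodmod_single i) (@single_is_linear i).

Definition lower (d : forall i, {linear T i.+1 -> T i}) (u : P) : P :=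
  fun i => d i (u i.+1).

Lemma lower_is_linear d : linear (lower d).
Proof. by move=> a u v; apply: product_moduleP => i; exact: linearP. Qed.

HB.instance Definition _ d :=
  GRing.isLinear.Build R P P _ (lower d) (lower_is_linear d).

Definition raise (d : forall i, {linear T i -> T i.+1}) (u : P) : P :=
  fun i => match i with 0%N => 0 | j.+1 => d j (u j) end.

Lemma raise_is_linear d : linear (raise d).
Proof.
move=> a u v; apply: product_moduleP => -[|i] /=; last exact: linearP.
by rewrite prodmodDE prodmodZE scaler0 addr0.
Qed.

HB.instance Definition _ d :=
  GRing.isLinear.Build R P P _ (raise d) (raise_is_linear d).

End ProductModule.

(** * Coordinates in a finite basis *)

Section FiniteBasis.
Variables (R : comNzRingType) (V W : lmodType R) (B : finType).
Variables (el : B -> V) (co : V -> B -> R).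
Hypothesis coP : forall a u v b, co (a *: u + v) b = a * co u b + co v b.
Hypothesis coE : forall v, v = \sum_b co v b *: el b.

(** For an ideal J this is the submodule J V, and [ann J] is the J-torsion of W. *)
Definition coord_in (J : R -> Prop) (v : V) := forall b, J (co v b).
Definition ann (J : R -> Prop) (z : W) := forall p, J p -> p *: z = 0.

Lemma ann_submodule J : submodule (ann J).
Proof.
split=> [p _|a u v Ju Jv p Jp]; first exact: scaler0.
by rewrite scalerDr scalerA mulrC -scalerA Ju // Jv // scaler0 addr0.
Qed.

Lemma co0 b : co 0 b = 0.
Proof.
have := coP 1 0 0 b; rewrite scaler0 addr0 mul1r => /eqP.
by rewrite -subr_eq0 opprD addrA subrr sub0r oppr_eq0 => /eqP.
Qed.

Lemma coD u v b : co (u + v) b = co u b + co v b.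
Proof. by rewrite -[u]scale1r coP mul1r scale1r. Qed.

Lemma coZ a u b : co (a *: u) b = a * co u b.
Proof. by rewrite -[a *: u]addr0 coP co0 addr0. Qed.

Lemma co_sum (I : Type) (r : seq I) (Q : pred I) (f : I -> V) b :
  co (\sum_(i <- r | Q i) f i) b = \sum_(i <- r | Q i) co (f i) b.
Proof.
by elim/big_rec2: _ => [|i y x _ <-]; [exact: co0 | exact: coD].
Qed.

Lemma coord_in_submodule (J : R -> Prop) :
  submodule (J : R^o -> Prop) -> submodule (coord_in J).
Proof.
move=> subJ; split=> [b|a u v Ju Jv b]; first by rewrite co0; case: subJ.
by rewrite coP; apply: (proj2 subJ); [exact: Ju | exact: Jv].
Qed.

Lemma coord_in_linear J (D : {linear V -> V}) v :
  submodule (J : R^o -> Prop) -> coord_in J v -> coord_in J (D v).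
Proof.
move=> subJ Jv b; rewrite [v]coE linear_sum co_sum.
apply: (submod_sum subJ) => b' _; rewrite linearZZ coZ mulrC.
exact: (submodZ subJ).
Qed.

Lemma linear_coord_in J (phi : {linear V -> W}) v :
  (forall v, ann J (phi v)) -> coord_in J v -> phi v = 0.
Proof.
move=> Wphi Jv; rewrite [v]coE linear_sum big1 // => b _.
by rewrite linearZZ; apply: Wphi; apply: Jv.
Qed.

Definition extend (w : B -> W) (v : V) : W := \sum_b co v b *: w b.

Lemma extend_is_linear w : linear (extend w).
Proof.
move=> a u v; rewrite /extend scaler_sumr -big_split /=; apply: eq_bigr => b _.
by rewrite coP scalerDl scalerA.
Qed.

HB.instance Definition _ w :=
  GRing.isLinear.Build R V W _ (extend w) (extend_is_linear w).

Hypothesis co_el : forall b b', co (el b) b' = (b == b')%:R.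

Lemma extend_el w b : extend w (el b) = w b.
Proof.
rewrite /extend (bigD1 b) //= co_el eqxx scale1r big1 ?addr0 // => b' neq.
by rewrite co_el eq_sym (negbTE neq) scale0r.
Qed.

(** On a free module the lift through multiplication by [x] may be chosen one basis element at a
    time. The predicate [Q] carries the degree conditions on these choices. *)
Lemma linear_lift (J : R -> Prop) x (phi : {linear V -> W})
    (Q : B -> W -> Prop) :
  (forall b, exists z, [/\ ann J z, Q b z & x *: z = phi (el b)]) ->
  exists w : {linear V -> W},
    [/\ forall v, ann J (w v), forall b, Q b (w (el b))
      & forall v, x *: w v = phi v].
Proof.
move=> lift; have [w wP] := choice lift.
exists (extend w : {linear V -> W}); split=> [v|b|v].
- apply: (submod_sum (ann_submodule J)) => b _.
  by apply: (submodZ (ann_submodule J)); case: (wP b).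
- by rewrite /= extend_el; case: (wP b).
- rewrite [in RHS](coE v) [RHS]linear_sum /= /extend scaler_sumr;
    apply: eq_bigr => b _.
  by rewrite scalerA mulrC -scalerA (linearZZ phi); case: (wP b) => _ _ ->.
Qed.

End FiniteBasis.

(** * Ideals generated by powers of variables *)

Section PowerIdeals.
Variables (k : fieldType) (n : nat).
Local Notation S := {mpoly k[n]}.

Definition in_power_mnm (e r : nat) (m : 'X_{1..n}) :=
  [exists i : 'I_n, (i < r)%N && (e <= m i)%N].

(* The ideal (x_1^e, ..., x_r^e). *)
Definition power_ideal (e r : nat) (p : S) : Prop :=
  forall m, ~~ in_power_mnm e r m -> p@_m = 0.

Lemma in_power_mnm_le e r (m m' : 'X_{1..n}) :
  (forall i, m i <= m' i)%N -> in_power_mnm e r m -> in_power_mnm e r m'.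
Proof.
move=> le_m /existsP [i /andP [ir ei]]; apply/existsP; exists i.
by rewrite ir (leq_trans ei).
Qed.

Lemma power_ideal_submodule e r : submodule (power_ideal e r : S^o -> Prop).
Proof.
split=> [m _|a u v Ju Jv m Nm]; first by rewrite mcoeff0.
rewrite mcoeffD (Jv _ Nm) addr0 /GRing.scale /= mcoeffM big1 // => -[m1 m2] /=.
move=> /eqP em; rewrite Ju ?mulr0 //.
apply: contra Nm; apply: in_power_mnm_le => i.
by have /mnmP/(_ i) -> := em; rewrite mnmDE leq_addl.
Qed.

Lemma power_idealX e r m : in_power_mnm e r m -> power_ideal e r 'X_[m].
Proof.
move=> Jm m' Nm'; rewrite mcoeffX; case: eqP => // em.
by rewrite em (negbTE Nm') in Jm.
Qed.

Lemma power_idealM e r (p q : S) : power_ideal e r q -> power_ideal e r (p * q).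
Proof. exact: (@submodZ _ _ _ (power_ideal_submodule e r) p q). Qed.

Lemma power_ideal_msupp e r (p : S) m :
  power_ideal e r p -> m \in msupp p -> in_power_mnm e r m.
Proof.
by move=> Jp; rewrite mcoeff_msupp; apply: contraR => /Jp ->.
Qed.

Lemma power_ideal_n0 e (p : S) : power_ideal e 0 p -> p = 0.
Proof.
move=> Jp; apply/mpolyP => m; rewrite mcoeff0; apply: Jp.
by apply/negP => /existsP [i]; rewrite ltn0.
Qed.

Lemma power_ideal_leq e e' r (p : S) :
  (e <= e')%N -> power_ideal e' r p -> power_ideal e r p.
Proof.
move=> le_e Jp m Nm; apply: Jp; apply: contra Nm => /existsP [i /andP[ir ei]].
by apply/existsP; exists i; rewrite ir (leq_trans le_e).
Qed.

Lemma in_power_mnmS e r (lt_rn : (r < n)%N) m :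
  in_power_mnm e r.+1 m =
    in_power_mnm e r m || (e <= m (Ordinal lt_rn))%N.
Proof.
apply/existsP/orP => [[i]|[/existsP [i /andP [ir ei]]|er]].
- rewrite ltnS leq_eqVlt => /andP [/orP [/eqP ir|ir] ei].
    by right; rewrite (_ : Ordinal lt_rn = i) //; apply: val_inj.
  by left; apply/existsP; exists i; rewrite ir.
- by exists i; rewrite ei andbT ltnS ltnW.
- by exists (Ordinal lt_rn); rewrite /= leqnn.
Qed.

Lemma in_power_mnmDX e r (lt_rn : (r < n)%N) m :
  in_power_mnm e r (m + U_(Ordinal lt_rn) *+ e)%MM = in_power_mnm e r m.
Proof.
apply: eq_existsb => i; case: ltnP => //= ir.
rewrite mnmDE mulmnE mnm1E (_ : (_ == i) = false) ?mul0n ?addn0 //.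
by apply/eqP => /(congr1 val) /= er; rewrite er ltnn in ir.
Qed.

(** Membership is decided on monomials by their first r exponents. The variable of index r, which is
    x_(r+1), does not affect these. *)
Lemma power_ideal_regular e r (lt_rn : (r < n)%N) (p : S) :
  power_ideal e r ('X_(Ordinal lt_rn) ^+ e * p) -> power_ideal e r p.
Proof.
move=> Jp m Nm; rewrite -(mcoeffMX p (U_(Ordinal lt_rn) *+ e)%MM) mulrC addmC.
by rewrite -mpolyXn; apply: Jp; rewrite in_power_mnmDX.
Qed.

(** The monomials of p whose exponent at x_(r+1) is at least e are divided by x_(r+1)^e. The others
    must already lie in the smaller ideal. *)
Lemma power_idealSP e r (lt_rn : (r < n)%N) (p : S) :
  power_ideal e r.+1 p <->
  exists q h, power_ideal e r h /\ p = 'X_(Ordinal lt_rn) ^+ e * q + h.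
Proof.
set i := Ordinal lt_rn; split=> [Jp|[q [h [Jh ->]]]].
- exists (\sum_(m <- msupp p | (e <= m i)%N) p@_m *: 'X_[m - U_(i) *+ e]).
  exists (\sum_(m <- msupp p | ~~ (e <= m i)%N) p@_m *: 'X_[m]); split.
    rewrite big_seq_cond.
    apply: (submod_sum (power_ideal_submodule e r)) => m /andP [mp em].
    rewrite -mul_mpolyC; apply: power_idealM; apply: power_idealX.
    by have := power_ideal_msupp Jp mp;
      rewrite (in_power_mnmS e lt_rn) (negbTE em) orbF.
  rewrite {1}[p]mpolyE (bigID (fun m : 'X_{1..n} => (e <= m i)%N)) /=.
  congr (_ + _); rewrite mulr_sumr; apply: eq_bigr => m em.
  rewrite mpolyXn -scalerAr -mpolyXD addmC submK //; apply/mnm_lepP => j.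
  by rewrite mulmnE mnm1E; case: eqP => [<-|]; rewrite ?mul1n ?mul0n.
- apply: (@submodD _ _ _ (power_ideal_submodule e r.+1)).
    rewrite mulrC; apply: power_idealM; rewrite mpolyXn; apply: power_idealX.
    by rewrite (in_power_mnmS e lt_rn) mulmnE mnm1E eqxx mul1n leqnn orbT.
  by move=> m; rewrite (in_power_mnmS e lt_rn) negb_or => /andP [Nm _];
    apply: Jh.
Qed.

(** The exponent of (x_1 ... x_r)^e. For r = n this monomial spans the socle of S/(x_1^(e+1), ...,
    x_n^(e+1)). *)
Definition power_mnm (e r : nat) : 'X_{1..n} :=
  [multinom (if (i < r)%N then e else 0%N) | i < n].

Lemma power_mnmS e r (lt_rn : (r < n)%N) :
  'X_[power_mnm e r.+1] = 'X_(Ordinal lt_rn) ^+ e * 'X_[power_mnm e r] :> S.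
Proof.
rewrite mpolyXn -mpolyXD; congr 'X_[_]; apply/mnmP => i.
rewrite mnmDE mulmnE mnm1E !mnmE -val_eqE /= ltnS leq_eqVlt [r == i]eq_sym.
by case: eqP => [->|_] /=; rewrite ?ltnn ?mul1n ?addn0 ?mul0n.
Qed.

(** A monomial divisible by some x_i with i <= r acquires exponent at least e+1 at x_i. *)
Lemma power_ideal_power_mnm e r (p : S) :
  power_ideal 1 r p -> power_ideal e.+1 r ('X_[power_mnm e r] * p).
Proof.
move=> Jp m Nm; rewrite mcoeffM big1 // => -[m1 m2] /= /eqP em.
rewrite mcoeffX; case: eqP => [e1|]; last by rewrite mul0r.
rewrite mul1r; apply: Jp; apply: contra Nm => /existsP [i /andP [ir ei]].
apply/existsP; exists i; rewrite ir; have /mnmP/(_ i) -> := em.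
by rewrite mnmDE -e1 mnmE ir -[e.+1]addn1 leq_add2l.
Qed.

Lemma power_mnm_notin e : ~ power_ideal e.+1 n ('X_[power_mnm e n] : S).
Proof.
have Nm : ~~ in_power_mnm e.+1 n (power_mnm e n).
  by apply/existsP => -[i]; rewrite mnmE; case: ifP; rewrite ?ltnn.
by move=> /(_ _ Nm) /eqP; rewrite mcoeffX eqxx oner_eq0.
Qed.

Lemma ann_power_idealP (W : lmodType S) e r (z : W) :
  (forall m, in_power_mnm e r m -> 'X_[m] *: z = 0) ->
  ann (power_ideal e r) z.
Proof.
move=> Jz p Jp; rewrite [p]mpolyE scaler_suml big_seq big1 // => m mp.
by rewrite -mul_mpolyC -scalerA Jz ?scaler0 // (power_ideal_msupp Jp).
Qed.

Lemma ann_power_idealS (W : lmodType S) e r (lt_rn : (r < n)%N) (z : W) :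
  ann (power_ideal e r.+1) z <->
  ann (power_ideal e r) z /\ 'X_(Ordinal lt_rn) ^+ e *: z = 0.
Proof.
split=> [Jz|[Jz xz] p /(power_idealSP e lt_rn) [q [h [Jh ->]]]].
  split=> [p Jp|]; apply: Jz; apply/(power_idealSP e lt_rn).
    by exists 0, p; rewrite mulr0 add0r.
  exists 1, 0; rewrite mulr1 addr0; split=> //.
  by move=> m _; rewrite mcoeff0.
by rewrite scalerDl (Jz _ Jh) addr0 mulrC -scalerA xz scaler0.
Qed.

Lemma coord_in_power_idealS (V : lmodType S) (B : finType) (el : B -> V)
    (co : V -> B -> S) e r (lt_rn : (r < n)%N) v :
  (forall a u v b, co (a *: u + v) b = a * co u b + co v b) ->
  (forall v, v = \sum_b co v b *: el b) ->
  (forall b b', co (el b) b' = (b == b')%:R) ->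
  coord_in co (power_ideal e r.+1) v <->
  exists g h, coord_in co (power_ideal e r) h /\
              v = 'X_(Ordinal lt_rn) ^+ e *: g + h.
Proof.
move=> coP coE co_el; split=> [Jv|[g [h [Jh ->]]] b]; last first.
  by rewrite coP; apply/(power_idealSP e lt_rn); exists (co g b), (co h b).
have split_co b : exists y : S * S, power_ideal e r y.2 /\
    co v b = 'X_(Ordinal lt_rn) ^+ e * y.1 + y.2.
  by have /(power_idealSP e lt_rn) [q [h H]] := Jv b; exists (q, h).
have [f fP] := choice split_co.
exists (\sum_b (f b).1 *: el b), (\sum_b (f b).2 *: el b); split.
  apply: (submod_sum (coord_in_submodule coP (power_ideal_submodule e r))).
  move=> b _ b'; rewrite (coZ coP) co_el mulrC; apply: power_idealM.
  exact: (proj1 (fP b)).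
rewrite scaler_sumr -big_split /= {1}[v]coE; apply: eq_bigr => b _.
by rewrite scalerA -scalerDl; case: (fP b) => _ ->.
Qed.

End PowerIdeals.

(** * Homogeneous ideals as graded modules *)

Section HomogeneousIdealModule.
Variables (k : fieldType) (n : nat).
Local Notation S := {mpoly k[n]}.

(** Such ideals, viewed as graded modules, are the test objects for graded injectivity. *)
Record homog_ideal := HomogIdeal {
  hi_mem :> S -> Prop;
  hi_submodule : submodule (hi_mem : S^o -> Prop);
  hi_pihomog : forall d p, hi_mem p -> hi_mem (pihomog mdeg d p)
}.

Definition hi_pred (J : homog_ideal) : {pred S^o} := fun p => `[< J p >].

Lemma hi_pred_closed J : submod_closed (hi_pred J).
Proof.
split=> [|a u v]; first by apply/asboolP; case: (hi_submodule J).
move=> /asboolP Ju /asboolP Jv; apply/asboolP.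
exact: (proj2 (hi_submodule J)).
Qed.

HB.instance Definition _ J :=
  GRing.isSubmodClosed.Build S S^o (hi_pred J) (hi_pred_closed J).

Record hi_sort (J : homog_ideal) := HiElt {
  hi_val : S^o;
  hi_valP : hi_pred J hi_val
}.

HB.instance Definition _ J := [isSub for @hi_val J].
HB.instance Definition _ J := [Choice of hi_sort J by <:].
HB.instance Definition _ J := [SubChoice_isSubLmodule of hi_sort J by <:].

Lemma hi_val0 J : hi_val (0 : hi_sort J) = 0.
Proof. exact: (raddf0 (val : hi_sort J -> S^o)). Qed.

Lemma hi_valD J : {morph @hi_val J : u v / u + v}.
Proof. exact: (raddfD (val : hi_sort J -> S^o)). Qed.

Lemma hi_valN J : {morph @hi_val J : u / - u}.
Proof. exact: (raddfN (val : hi_sort J -> S^o)). Qed.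

Lemma hi_valZ J a (u : hi_sort J) : hi_val (a *: u) = a * hi_val u.
Proof. exact: (linearZZ (val : hi_sort J -> S^o)). Qed.

Lemma hi_val_sum J (I : Type) (r : seq I) (f : I -> hi_sort J) :
  hi_val (\sum_(i <- r) f i) = \sum_(i <- r) hi_val (f i).
Proof. exact: (raddf_sum (val : hi_sort J -> S^o)). Qed.

(** Integer degrees accommodate the shifts; for negative d only p = 0 qualifies. *)
Definition homogz (d : int) (p : S) := forall m, m \in msupp p ->
  (mdeg m)%:Z = d.

Lemma homogzP (e : nat) p : homogz e%:Z p <-> p \is e.-homog for mdeg.
Proof.
split=> [H|/dhomogP H m mp]; last by rewrite (H m mp).
by apply/dhomogP => m mp; have /eqP := H m mp; rewrite eqz_nat => /eqP.
Qed.

Lemma homogzM d e p q : homogz d p -> homogz e q -> homogz (d + e) (p * q).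
Proof.
move=> hp hq m /msuppM_le /allpairsP [[m1 m2] /= [m1p m2q ->]].
by rewrite mdegD PoszD (hp _ m1p) (hq _ m2q).
Qed.

Lemma homogzX m : homogz (mdeg m)%:Z ('X_[m]).
Proof. by move=> m'; rewrite msuppX inE => /eqP ->. Qed.

Definition pihomogz (d : int) (p : S) : S :=
  if d is Posz e then pihomog mdeg e p else 0.

Lemma pihomogz_homog d p : homogz d (pihomogz d p).
Proof.
case: d => e /=; first by apply/homogzP; exact: pihomogP.
by move=> m; rewrite msupp0.
Qed.

Lemma pihomogz_id d p : homogz d p -> pihomogz d p = p.
Proof.
case: d => e hp; first by apply: pihomog_dE; apply/homogzP.
apply/mpolyP => m; rewrite mcoeff0; apply/esym/memN_msupp_eq0/negP => mp.
by have := hp m mp.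
Qed.

Lemma pihomogzD d p q : pihomogz d (p + q) = pihomogz d p + pihomogz d q.
Proof. by case: d => e /=; rewrite ?addr0 // pihomogD. Qed.

Lemma pihomogz_homogz d e p :
  homogz e p -> pihomogz d p = if d == e then p else 0.
Proof.
case: eqP => [->|/eqP de hp]; first exact: pihomogz_id.
case: d de => // d de; case: e hp de => e hp de; last first.
  have -> : p = 0 by rewrite -(pihomogz_id hp).
  by apply: pihomogz_id => m; rewrite msupp0.
by apply: (pihomog_ne0 (d := e)); [rewrite eq_sym | apply/homogzP].
Qed.

Lemma pihomogzM d e p q :
  homogz e p -> pihomogz (e + d) (p * q) = p * pihomogz d q.
Proof.
move=> hp; have pi0 d' : pihomogz d' 0 = 0 by apply: pihomogz_id => m;
  rewrite msupp0.
rewrite {1 2}[q]mpolyE mulr_sumr !(big_morph _ (@pihomogzD _) (pi0 _))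
  mulr_sumr.
apply: eq_bigr => m _; have hm : homogz (mdeg m) (q@_m *: 'X_[m]).
  by move=> m' /msuppZ_le; apply: homogzX.
rewrite (pihomogz_homogz _ hm) (pihomogz_homogz _ (homogzM hp hm)).
by rewrite (inj_eq (addrI e)); case: eqP => // _; rewrite mulr0.
Qed.

Lemma pihomogz_in (J : homog_ideal) d p : J p -> J (pihomogz d p).
Proof.
move=> Jp; case: d => e /=; first exact: hi_pihomog.
by case: (hi_submodule J).
Qed.

Variables (J : homog_ideal) (c : int).

(** This grading is that of the shift J(-c), in which the polynomial 1 has degree c. *)
Definition hi_comp (d : int) (v : hi_sort J) := homogz (d - c) (hi_val v).

Lemma hi_comp0 d : hi_comp d 0.
Proof. by move=> m; rewrite hi_val0 msupp0. Qed.

Lemma hi_compB d u v : hi_comp d u -> hi_comp d v -> hi_comp d (u - v).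
Proof.
rewrite /hi_comp hi_valD hi_valN => hu hv m /msuppB_le.
by rewrite mem_cat => /orP [/hu|/hv].
Qed.

Lemma hi_compZ (e : nat) d (p : S) v :
  p \is e.-homog for mdeg -> hi_comp d v -> hi_comp (e%:Z + d) (p *: v).
Proof.
move=> /homogzP hp hv; rewrite /hi_comp hi_valZ -addrA.
exact: homogzM.
Qed.

Lemma hi_comp_span v : exists (s : seq int) (f : int -> hi_sort J),
  (forall d, hi_comp d (f d)) /\ v = \sum_(d <- s) f d.
Proof.
have Pv d : hi_pred J (pihomogz d (hi_val v)).
  by apply/asboolP/pihomogz_in/asboolP/hi_valP.
exists [seq e%:Z + c | e <- iota 0 (msize (hi_val v))].
exists (fun d => HiElt (Pv (d - c))); split=> [d|]; first exact: pihomogz_homog.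
apply: val_inj; rewrite /= hi_val_sum big_map /=.
rewrite {1}(pihomog_partitionE (leqnn (mmeasure mdeg (hi_val v)))).
rewrite -(big_mkord xpredT (fun e => pihomog mdeg e (hi_val v))) /index_iota
  subn0.
by apply: eq_bigr => e _; rewrite addrK.
Qed.

Lemma hi_comp_direct (s : seq int) (f : int -> hi_sort J) : uniq s ->
  (forall d, hi_comp d (f d)) -> \sum_(d <- s) f d = 0 ->
  forall d, d \in s -> f d = 0.
Proof.
move=> us hf sum0 d ds; apply: val_inj.
transitivity (0 : S); last by rewrite -(hi_val0 J).
apply/mpolyP => m; rewrite mcoeff0; apply/eqP; rewrite mcoeff_eq0;
  apply/negP => md.
have dm := hf d m md; have := congr1 (fun v => (hi_val v)@_m) sum0.
rewrite hi_val0 mcoeff0 hi_val_sum (bigD1_seq d) // mcoeffD raddf_sum big1.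
  by rewrite addr0 => /eqP; rewrite mcoeff_eq0 md.
move=> e ed; apply: memN_msupp_eq0; apply: contra ed => me.
by have := hf e m me; rewrite dm => /addIr ->.
Qed.

Definition hi_module : gradedModule k n :=
  GradedModule hi_comp0 hi_compB hi_compZ hi_comp_span hi_comp_direct.

End HomogeneousIdealModule.

(** * Graded modules and coregularity *)

Section GradedModuleTheory.
Variables (k : fieldType) (n : nat) (N : gradedModule k n).
Local Notation S := {mpoly k[n]}.

Lemma gr_compN d (u : N) : gr_comp d u -> gr_comp d (- u).
Proof. by move=> hu; rewrite -sub0r; apply: gr_compB (gr_comp0 _ d) hu. Qed.

Lemma gr_compD d (u v : N) : gr_comp d u -> gr_comp d v -> gr_comp d (u + v).
Proof. by move=> hu /gr_compN hv; rewrite -[v]opprK; apply: gr_compB. Qed.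

Lemma gr_comp_homogz d e (p : S) (v : N) :
  homogz d p -> gr_comp e v -> gr_comp (d + e) (p *: v).
Proof.
case: d => d hp hv; first by apply: gr_compZ => //; apply/homogzP.
rewrite (_ : p = 0) ?scale0r; first exact: gr_comp0.
by rewrite -(pihomogz_id hp).
Qed.

Lemma gr_comp_mnm d m (v : N) :
  gr_comp d v -> gr_comp ((mdeg m)%:Z + d) ('X_[m] *: v).
Proof. by apply: gr_comp_homogz; exact: homogzX. Qed.

(** Terms of equal degree are collected, because [gr_comp_direct] speaks of distinct degrees. *)
Lemma gr_comp_merge (r : seq (int * N)) :
  (forall p, p \in r -> gr_comp p.1 p.2) ->
  exists f : int -> N, (forall d, gr_comp d (f d)) /\
    \sum_(p <- r) p.2 = \sum_(d <- undup (unzip1 r)) f d.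
Proof.
move=> hr; exists (fun d => \sum_(p <- r | p.1 == d) p.2); split=> [d|].
  rewrite big_seq_cond; apply: (big_ind (gr_comp d)).
  - exact: gr_comp0.
  - exact: gr_compD.
  - by move=> p /andP [/hr hp /eqP <-].
rewrite (exchange_big_dep predT) //= big_seq [RHS]big_seq.
apply: eq_bigr => p pr; rewrite -big_filter (@eq_filter _ _ (pred1 p.1)).
  rewrite filter_pred1_uniq ?undup_uniq ?big_seq1 //.
  by rewrite mem_undup; apply/mapP; exists p.
by move=> d; rewrite /= eq_sym.
Qed.

(** This takes the place of a projection to degree d: an equation is read modulo [off_degree d], and
    [off_degree_eq0] turns it into an equality in degree d. *)
Definition off_degree (d : int) (v : N) := exists r : seq (int * N),
  (forall p, p \in r -> p.1 != d /\ gr_comp p.1 p.2) /\ v = \sum_(p <- r) p.2.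

Lemma off_degree0 d : off_degree d 0.
Proof. by exists [::]; rewrite big_nil. Qed.

Lemma off_degreeD d u v : off_degree d u -> off_degree d v ->
  off_degree d (u + v).
Proof.
move=> [r [hr ->]] [q [hq ->]]; exists (r ++ q); rewrite big_cat; split=> // p.
by rewrite mem_cat => /orP [/hr|/hq].
Qed.

Lemma off_degree_comp d e v : e != d -> gr_comp e v -> off_degree d v.
Proof.
move=> ed hv; exists [:: (e, v)]; rewrite big_seq1; split=> // p.
by rewrite inE => /eqP ->.
Qed.

Lemma off_degree_eq0 d v : gr_comp d v -> off_degree d v -> v = 0.
Proof.
move=> hv [r [hr vE]]; have [|f [hf fE]] := @gr_comp_merge r.
  by move=> p /hr [].
have dr : d \notin undup (unzip1 r).
  rewrite mem_undup; apply/negP => /mapP [p /hr [pd _] dp].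
  by rewrite dp eqxx in pd.
(* With - v placed in degree d, the collected family sums to zero, and directness gives v = 0. *)
pose g e := if e == d then - v else f e.
have gr_g e : gr_comp e (g e).
  by rewrite /g; case: eqP => [->|_]; [exact: gr_compN | exact: hf].
have := gr_comp_direct (s := d :: undup (unzip1 r)) (f := g).
rewrite /= dr undup_uniq => /(_ isT gr_g); rewrite big_cons {1}/g eqxx.
rewrite (eq_big_seq f) => [|e er]; last first.
  by rewrite /g; case: eqP => // ed; rewrite -ed er in dr.
rewrite -fE -vE addNr => /(_ erefl d); rewrite inE eqxx /g eqxx => /(_ isT).
by move/eqP; rewrite oppr_eq0 => /eqP.
Qed.

Lemma gr_decomposition (v : N) : exists (s : seq int) (f : int -> N),
  [/\ uniq s, forall d, gr_comp d (f d) & v = \sum_(d <- s) f d].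
Proof.
have [s [f [hf ->]]] := gr_comp_span v.
have [|g [hg gE]] := @gr_comp_merge [seq (d, f d) | d <- s].
  by move=> p /mapP [d _ ->].
exists (undup (unzip1 [seq (d, f d) | d <- s])), g; split=> //.
  exact: undup_uniq.
by rewrite -gE big_map.
Qed.

(** The ideal is spanned by monomials, and a monomial shifts all degrees by the same amount, so the
    products with distinct components cannot cancel. *)
Lemma ann_power_ideal_component e r (s : seq int) (f : int -> N) :
  uniq s -> (forall d, gr_comp d (f d)) ->
  ann (power_ideal e r) (\sum_(d <- s) f d) ->
  forall d, d \in s -> ann (power_ideal e r) (f d).
Proof.
move=> us hf Js d ds; apply: ann_power_idealP => m Jm.
pose c := (mdeg m)%:Z.
have := gr_comp_direct (s := [seq c + d | d <- s])
  (f := fun d' => 'X_[m] *: f (d' - c)).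
rewrite map_inj_uniq => [/(_ us)|]; last exact: addrI.
rewrite big_map; under eq_bigr => d' _ do rewrite addrC addKr.
rewrite -scaler_sumr (Js _ (power_idealX k Jm)) => /(_ _ erefl (c + d)).
rewrite [c + d - c]addrC addKr; apply; last exact: map_f.
by move=> d'; rewrite -{1}[d'](subrK c) addrC; apply: gr_comp_mnm.
Qed.

Lemma ann_component e r d (v : N) : ann (power_ideal e r) v ->
  exists u, [/\ gr_comp d u, ann (power_ideal e r) u & off_degree d (v - u)].
Proof.
have [s [f [us hf ->]]] := gr_decomposition v => Js.
have offs (q : seq int) : d \notin q -> off_degree d (\sum_(e <- q) f e).
  move=> dq; rewrite big_seq; apply: (big_ind (off_degree d)).
  - exact: off_degree0.
  - exact: off_degreeD.
  - by move=> e' eq; apply: off_degree_comp (hf e'); apply: contraNneq dq => <-.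
have [ds|ds] := boolP (d \in s); last first.
  exists 0; rewrite subr0; split; first exact: gr_comp0; last exact: offs.
  exact: (submod0 (ann_submodule N _)).
exists (f d); split=> //; first exact: (ann_power_ideal_component us hf Js).
rewrite (bigD1_seq d) //= addrC addrK -big_filter; apply: offs.
by rewrite mem_filter eqxx.
Qed.

End GradedModuleTheory.

(** * Coregularity of graded injectives *)

Section Coregularity.
Variables (k : fieldType) (n : nat).
Local Notation S := {mpoly k[n]}.

Lemma power_ideal_pihomog e r d (p : S) :
  power_ideal e r p -> power_ideal e r (pihomog mdeg d p).
Proof.
move=> Jp; rewrite pihomogE big_seq_cond.
apply: (submod_sum (power_ideal_submodule k n e r)) => m /andP [mp _].
rewrite -mul_mpolyC; apply: power_idealM; apply: power_idealX.
exact: power_ideal_msupp mp.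
Qed.

Definition power_homog_ideal e r : homog_ideal k n :=
  HomogIdeal (@power_ideal_submodule k n e r) (@power_ideal_pihomog e r).

Definition unit_homog_ideal : homog_ideal k n :=
  @HomogIdeal k n (fun=> True) (conj I (fun _ _ _ _ _ => I)) (fun _ _ _ => I).

Variables (Q : gradedModule k n) (injQ : graded_injective Q).

(* On (x_1^e, ..., x_(r+1)^e), the map x_(r+1)^e q + h |-> q u with h in
   (x_1^e, ..., x_r^e) is well defined; w is the image of 1 under an extension
   of this map to S. *)
Lemma graded_injective_coregular e r (lt_rn : (r < n)%N) c (u : Q) :
  gr_comp c u -> ann (power_ideal e r) u ->
  exists w, [/\ ann (power_ideal e r) w, gr_comp (c - e%:Z) w
              & 'X_(Ordinal lt_rn) ^+ e *: w = u].
Proof.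
set x := 'X_(Ordinal lt_rn) ^+ e => hu Ju.
(* The shift by c - e gives x_(r+1)^e the degree c of [u], so that [f] will have degree 0. *)
pose A := hi_module (power_homog_ideal e r.+1) (c - e%:Z).
pose B := hi_module unit_homog_ideal (c - e%:Z).
have decA (a : A) : exists q h, power_ideal e r h /\ hi_val a = x * q + h.
  by have /asboolP /(power_idealSP e lt_rn) := hi_valP a.
pose f (a : A) : Q := projT1 (cid (decA a)) *: u.
(* Two decompositions have quotients that differ by an element of (x_1^e, ..., x_r^e), since x is
   regular modulo this ideal; and this ideal kills [u]. *)
have fE (a : A) q h : power_ideal e r h -> hi_val a = x * q + h -> f a = q *: u.
  move=> Jh aE; rewrite /f; case: cid => q' [h' [Jh' aE']] /=.
  apply/eqP; rewrite -subr_eq0 -scalerBl; apply/eqP; apply: Ju.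
  apply: (power_ideal_regular (e := e) (lt_rn := lt_rn)); rewrite -/x.
  have -> : x * (q' - q) = h - h'.
    have hE : h = hi_val a - x * q by rewrite aE addrC addKr.
    have hE' : h' = hi_val a - x * q' by rewrite aE' addrC addKr.
    by rewrite hE hE'; ring.
  exact: (submodB (power_ideal_submodule k n e r)).
have f_linear : linear f.
  move=> a v1 v2; have [q1 [h1 [J1 E1]]] := decA v1.
  have [q2 [h2 [J2 E2]]] := decA v2; rewrite (fE _ _ _ J1 E1) (fE _ _ _ J2 E2).
  rewrite scalerA -scalerDl; apply: (fE _ _ (a * h1 + h2)).
    by apply: (proj2 (power_ideal_submodule k n e r)).
  by rewrite hi_valD hi_valZ E1 E2; ring.
pose fL : {linear A ->
  Q} := HB.pack f (GRing.isLinear.Build S A Q _ f f_linear).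
have TB (p : S) : hi_pred unit_homog_ideal p by apply/asboolP.
pose i (a : A) : B := HiElt (TB (hi_val a)).
have i_linear : linear i.
  move=> a v1 v2; apply: val_inj.
  transitivity (hi_val (a *: v1 + v2)); first by [].
  transitivity (a * hi_val (i v1) + hi_val (i v2)).
    by rewrite hi_valD hi_valZ.
  by rewrite [RHS]hi_valD hi_valZ.
pose iL : {linear A ->
  B} := HB.pack i (GRing.isLinear.Build S A B _ i i_linear).
have [||d a ha|g [hg gE]] := injQ (u := iL) (f := fL).
- by move=> d a.
- by move=> a b /(congr1 (@hi_val _ _ _)) /= /val_inj.
(* The chosen q need not be homogeneous. Projecting the decomposition to the degree of [a] gives a
   homogeneous one, and [fE] allows its use. *)
- have [q [h [Jh aE]]] := decA a.
  have pE : hi_val a = x * pihomogz (d - (c - e%:Z) - e%:Z) q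
                       + pihomogz (d - (c - e%:Z)) h.
    rewrite -(pihomogz_id ha) aE pihomogzD -(@pihomogzM k n _ e%:Z).
      by rewrite [_ + (_ - e%:Z)]addrCA subrr addr0.
    by have := @homogzX k n (U_(Ordinal lt_rn) *+ e)%MM;
      rewrite mdegMn mdeg1 mul1n -mpolyXn.
  have Jh' := @pihomogz_in k n (power_homog_ideal e r) (d - (c - e%:Z)) h Jh.
  rewrite /= (fE _ _ _ Jh' pE).
  have := gr_comp_homogz (@pihomogz_homog k n (d - (c - e%:Z) - e%:Z) q) hu.
  by rewrite (_ : d - (c - e%:Z) - e%:Z + c = d) //; ring.
have {}gE (a : A) : g (i a) = f a := gE a.
have gZ (p : S) : g (HiElt (TB p)) = p *: g (HiElt (TB 1)).
  rewrite -linearZZ; congr (g _); apply: val_inj.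
  by rewrite [RHS]hi_valZ mulr1.
have Jx : hi_pred (power_homog_ideal e r.+1) x.
  apply/asboolP/(power_idealSP e lt_rn); exists 1, 0; rewrite mulr1 addr0.
  by split=> // m _; rewrite mcoeff0.
exists (g (HiElt (TB 1))); split.
- move=> p Jp; rewrite -gZ.
  have Jp' : hi_pred (power_homog_ideal e r.+1) p.
    apply/asboolP/(power_idealSP e lt_rn); exists 0, p.
    by rewrite mulr0 add0r.
  by have := gE (HiElt Jp'); rewrite (fE _ 0 p) ?scale0r // mulr0 add0r.
- have h1 : hi_comp (J :=
    unit_homog_ideal) (c - e%:Z) (c - e%:Z) (HiElt (TB 1)).
    by move=> m; rewrite msupp1 inE => /eqP ->; rewrite mdeg0 subrr.
  exact: (hg _ _ h1).
- rewrite -gZ; have := gE (HiElt Jx);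
    rewrite (fE _ 1 0) ?scale1r ?mulr1 ?addr0 //.
  by move=> m _; rewrite mcoeff0.
Qed.

Lemma injective_coregular e r (lt_rn : (r < n)%N) (u : Q) :
  ann (power_ideal e r) u ->
  exists w, ann (power_ideal e r) w /\ 'X_(Ordinal lt_rn) ^+ e *: w = u.
Proof.
have [s [f [us hf ->]]] := gr_decomposition u => Js.
have lift d : exists w, d \in s ->
    ann (power_ideal e r) w /\ 'X_(Ordinal lt_rn) ^+ e *: w = f d.
  have [ds|_] := boolP (d \in s); last by exists 0.
  have Jd := ann_power_ideal_component us hf Js ds.
  by have [w [Jw _ wE]] := graded_injective_coregular lt_rn (hf d) Jd; exists w.
have [w wP] := choice lift; exists (\sum_(d <- s) w d); split.
  rewrite big_seq; apply: (submod_sum (ann_submodule Q _)) => d ds.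
  by case: (wP d ds).
rewrite scaler_sumr; apply: eq_big_seq => d ds.
by case: (wP d ds).
Qed.

End Coregularity.

(** * Torsion *)

Section Torsion.
Variables (k : fieldType) (n : nat).
Local Notation S := {mpoly k[n]}.

Lemma irrelevant_pow0 e : irrelevant_pow e (0 : S).
Proof.
elim: e => // e IHe; exists (fun=> 0); split=> //.
by rewrite big1 // => i _; rewrite mulr0.
Qed.

Lemma irrelevant_powX e (m : 'X_{1..n}) :
  (e <= mdeg m)%N -> irrelevant_pow e ('X_[m] : S).
Proof.
elim: e m => // e IHe m em.
have [i mi] : exists i, m i != 0%N.
  apply/existsP; rewrite -[[exists _, _]]negbK negb_exists;
    apply/negP => /forallP m0.
  by move: em; rewrite mdegE big1 // => i _; apply/eqP; have := m0 i;
    rewrite negbK.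
have mE : m = (U_(i) + (m - U_(i)))%MM.
  rewrite addmC submK //; apply/mnm_lepP => j; rewrite mnm1E.
  by case: eqP => [<-|] //; rewrite lt0n.
exists (fun j => if j == i then 'X_[m - U_(i)] else 0); split=> [j|].
  case: eqP => _; last exact: irrelevant_pow0.
  by apply: IHe; move: em; rewrite {1}mE mdegD mdeg1.
rewrite (bigD1 i) //= eqxx big1 ?addr0 => [|j /negbTE ->];
  last by rewrite mulr0.
by rewrite -mpolyXD -mE.
Qed.

Lemma irrelevant_pow_mdeg e (p : S) m :
  irrelevant_pow e p -> m \in msupp p -> (e <= mdeg m)%N.
Proof.
elim: e p m => // e IHe p m [q [hq ->]].
rewrite mcoeff_msupp raddf_sum /= => nz.
have [i] : exists i, ('X_i * q i)@_m != 0.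
  apply/existsP; apply: contraR nz; rewrite negb_exists => /forallP z.
  by rewrite big1 // => i _; apply/eqP; have := z i; rewrite negbK.
rewrite -mcoeff_msupp => /msuppM_le /allpairsP [[m1 m2] /= [m1X m2q ->]].
move: m1X; rewrite msuppX inE => /eqP ->; rewrite mdegD mdeg1.
exact: IHe (hq i) m2q.
Qed.

(** Pigeonhole: n exponents that are all at most e have sum at most n e. This bounds the degrees of
    S/(x_1^(e+1), ..., x_n^(e+1)). *)
Lemma mdeg_in_power_mnm e (m : 'X_{1..n}) :
  (n * e < mdeg m)%N -> in_power_mnm e.+1 n m.
Proof.
move=> lt_m; apply/existsP; apply/existsP; apply: contraLR lt_m.
rewrite negb_exists -leqNgt => /forallP le_m.
rewrite mdegE -[n in (n * e)%N]card_ord -sum_nat_const.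
by apply: leq_sum => i _; have := le_m i; rewrite ltn_ord -leqNgt.
Qed.

Variable N : gradedModule k n.

(** The ideals (x_1^e, ..., x_n^e) are cofinal with the powers of (x_1, ..., x_n); the converse is
    [ann_in_torsion]. *)
Lemma in_torsion_ann (z : N) :
  in_torsion z -> exists e, ann (power_ideal e.+1 n) z.
Proof.
move=> [e tz]; exists e; apply: ann_power_idealP => m /existsP [i /andP [_ mi]].
apply: tz; apply: irrelevant_powX; rewrite mdegE (bigD1 i) //=.
by rewrite (leq_trans (ltnW mi)) // leq_addr.
Qed.

Lemma ann_in_torsion e (z : N) : ann (power_ideal e n) z -> in_torsion z.
Proof.
move=> Jz; exists (n * e).+1 => p tp; apply: Jz => m Nm.
apply: memN_msupp_eq0; apply/negP => /(irrelevant_pow_mdeg tp) mp.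
case/negP: Nm; have /existsP [i /andP [ir ei]] := mdeg_in_power_mnm mp.
by apply/existsP; exists i; rewrite ir ltnW.
Qed.

Lemma off_degree_map (N' : gradedModule k n) (f : {linear N -> N'}) d v :
  degree0 f -> off_degree d v -> off_degree d (f v).
Proof.
move=> hf [r [hr ->]]; rewrite linear_sum big_seq;
  apply: (big_ind (off_degree d)).
- exact: off_degree0.
- exact: off_degreeD.
- by move=> p /hr [pd hp]; apply: off_degree_comp pd _; apply: hf.
Qed.

End Torsion.

(** * Comparison of the free and the injective resolution *)

Lemma big_tagged (A : nmodType) (I : finType) (J : I -> finType)
    (G : {i : I & J i} -> A) :
  \sum_b G b = \sum_i \sum_(j : J i) G (Tagged J j).
Proof. by rewrite sig_big_dep; apply: eq_bigr => -[]. Qed.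

Section HomogeneousCoefficients.
Variables (k : fieldType) (n : nat) (N : gradedModule k n).
Local Notation S := {mpoly k[n]}.

Lemma mcoeff_pihomogz d (p : S) m :
  (pihomogz d p)@_m = if (mdeg m)%:Z == d then p@_m else 0.
Proof.
case: d => d; last by rewrite /= mcoeff0.
rewrite /= pihomogE big_mkcond [in RHS](mpolyE p) eqz_nat !raddf_sum /=.
case: eqP => md; last first.
  apply: big1 => m' _; case: eqP => m'd; rewrite ?mcoeff0 // mcoeffZ mcoeffX.
  by case: eqP => [mm'|]; rewrite ?mulr0 //; rewrite -mm' in md.
apply: eq_bigr => m' _; case: eqP => // m'd; rewrite mcoeff0 mcoeffZ mcoeffX.
by case: eqP => [mm'|]; rewrite ?mulr0 // mm' in m'd *.
Qed.

(** Each term of p moves v into a single degree, so only the monomials that lead to degree d need to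
    kill v. *)
Lemma off_degree_scale d e (p : S) (v : N) :
  (forall m, m \in msupp p -> (mdeg m)%:Z + e = d -> 'X_[m] *: v = 0) ->
  gr_comp e v -> off_degree d (p *: v).
Proof.
move=> pv hv; rewrite [p]mpolyE scaler_suml big_seq.
apply: (big_ind (off_degree d)).
- exact: off_degree0.
- exact: off_degreeD.
move=> m mp; rewrite -mul_mpolyC -scalerA.
have [md|md] := eqVneq ((mdeg m)%:Z + e) d.
  by rewrite pv // scaler0; exact: off_degree0.
apply: off_degree_comp md _; rewrite -[_ + e]add0r; apply: gr_comp_homogz.
  move=> m'; rewrite msuppC; case: ifP => // _; rewrite inE => /eqP ->.
    by rewrite mdeg0.
exact: gr_comp_mnm.
Qed.

Lemma off_degree_scale_pihomogz d e (p : S) (v : N) :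
  gr_comp e v -> off_degree d ((p - pihomogz (d - e) p) *: v).
Proof.
move=> hv; apply: off_degree_scale hv => m mp dE; exfalso; move: mp.
by rewrite mcoeff_msupp mcoeffB mcoeff_pihomogz -dE addrK eqxx subrr eqxx.
Qed.

End HomogeneousCoefficients.

Section HomogeneousBasis.
Variables (k : fieldType) (n : nat) (N : gradedModule k n) (B : homog_basis N).
Local Notation S := {mpoly k[n]}.
Local Notation r := (basis_rank B).

Definition basis_coord (v : N) : 'rV[S]_r := projT1 (cid (basis_unique B v)).

Lemma basis_coordE v : v = \sum_j basis_coord v 0 j *: basis_elt j.
Proof. by rewrite /basis_coord; case: cid => c /= []. Qed.

Lemma basis_coord_unique v (c : 'rV[S]_r) :
  v = \sum_j c 0 j *: basis_elt j -> basis_coord v = c.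
Proof. by rewrite /basis_coord; case: cid => c' /= [_ uniq_c] /uniq_c. Qed.

Lemma basis_coordP a u v : basis_coord (a *: u + v) = a *:
  basis_coord u + basis_coord v.
Proof.
apply: basis_coord_unique; rewrite {1}[u]basis_coordE {1}[v]basis_coordE.
rewrite scaler_sumr -big_split /=; apply: eq_bigr => j _.
by rewrite !mxE scalerDl scalerA.
Qed.

Lemma basis_coord0 : basis_coord 0 = 0.
Proof.
by apply: basis_coord_unique; rewrite big1 // => j _; rewrite mxE scale0r.
Qed.

Lemma basis_coord_elt i : basis_coord (basis_elt i : N) = delta_mx 0 i.
Proof.
apply: basis_coord_unique; rewrite (bigD1 i) //= big1 ?addr0 => [|j ji].
  by rewrite mxE !eqxx scale1r.
by rewrite mxE eqxx (negbTE ji) scale0r.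
Qed.

(** Truncating every coordinate to its expected degree changes v by an element that is both of
    degree d and [off_degree d], hence zero. Coordinates being unique, the truncation changed
    nothing. *)
Lemma basis_coord_homogz d (v : N) j :
  gr_comp d v -> homogz (d - basis_deg j) (basis_coord v 0 j).
Proof.
move=> hv; pose c : 'rV[S]_r :=
  \row_i pihomogz (d - basis_deg i) (basis_coord v 0 i).
suff -> : basis_coord v = c by rewrite mxE; apply: pihomogz_homog.
apply: basis_coord_unique; apply/eqP; rewrite -subr_eq0; apply/eqP.
apply: (@off_degree_eq0 _ _ _ d).
  apply: gr_compB hv _; apply: (big_ind (gr_comp d)).
  - exact: gr_comp0.
  - by move=> ? ?; apply: gr_compD.
  - move=> i _; rewrite mxE -{1}[d](subrK (basis_deg i)).
    by apply: gr_comp_homogz; [exact: pihomogz_homog | exact: basis_homog].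
rewrite {1}[v]basis_coordE -sumrB; apply: (big_ind (off_degree d)).
- exact: off_degree0.
- exact: off_degreeD.
- move=> i _; rewrite mxE -scalerBl.
  exact: off_degree_scale_pihomogz (basis_homog _).
Qed.

End HomogeneousBasis.

Section Comparison.
Variables (k : fieldType) (n : nat) (M : gradedModule k n) (s : nat).
Variables (F : minimal_free_resolution M s) (I : injective_resolution M).
Local Notation S := {mpoly k[n]}.
Local Notation V := (product_module (fun i => free_term F i : lmodType S)).
Local Notation W := (product_module (fun j => inj_term I j : lmodType S)).
Local Notation D := (lower (T := fun i => free_term F i :
  lmodType S) (free_diff F)).
Local Notation E := (raise (T := fun j => inj_term I j :
  lmodType S) (inj_diff I)).
Local Notation B := {i : 'I_s.+1 & 'I_(basis_rank (free_basis F i))}.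

Implicit Types (b : B) (v : V) (z : W).

Definition bpos b : nat := tag b.
Definition bdeg b : int := basis_deg (tagged b).
Definition bel b : V :=
  prodmod_single (T := fun i => free_term F i : lmodType S)
    (basis_elt (tagged b)).
Definition bco v b :
  S := basis_coord (free_basis F (bpos b)) (v (bpos b)) 0 (tagged b).

Lemma bcoP a u v b : bco (a *: u + v) b = a * bco u b + bco v b.
Proof. by rewrite /bco prodmodDE prodmodZE basis_coordP !mxE. Qed.

(** Above position s the product has only zero terms, so the finitely many generators up to s form a
    basis of all of [V]. *)
Lemma bcoE v : v = \sum_b bco v b *: bel b.
Proof.
apply: product_moduleP => i; rewrite prodmod_sumE.
have [lt_is|lt_si] := ltnP i s.+1; last first.
  by rewrite [LHS](free_length lt_si) [RHS](free_length lt_si).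
rewrite [RHS]big_tagged.
rewrite (bigD1 (Ordinal lt_is)) //= [X in _ + X]big1 ?addr0.
  rewrite [LHS](basis_coordE (free_basis F i)); apply: eq_bigr => j _.
  by rewrite prodmodZE /bel single_in.
move=> l li; apply: big1 => j _; rewrite prodmodZE /bel single_out ?scaler0 //.
Qed.

Lemma bco_bel b b' : bco (bel b) b' = (b == b')%:R.
Proof.
rewrite /bco /bel; case: b b' => [i j] [i' j'] /=.
have [ii|ii] := eqVneq i i'.
  subst i'; rewrite single_in basis_coord_elt mxE eqxx eq_sym; congr (_%:R).
  congr nat_of_bool; apply/eqP/eqP => [->|] //.
  by move=> /eqP; rewrite -tag_eqE /tag_eq eqxx /= tagged_asE => /eqP.
rewrite single_out // basis_coord0 mxE -tag_eqE /tag_eq /= (negbTE ii) //.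
Qed.

(** The element sits in position r - q alone, and is zero if q > r. Here q will be a position in F
    and r the number of variables treated. *)
Definition in_spot (q r : nat) (d : int) (z : W) :=
  forall j, if (q + j == r)%N then gr_comp d (z j) else z j = 0.

Lemma in_spot0 q r d : in_spot q r d 0.
Proof. by move=> j; case: ifP => // _; exact: gr_comp0. Qed.

Lemma in_spotB q r d z1 z2 :
  in_spot q r d z1 -> in_spot q r d z2 -> in_spot q r d (z1 - z2).
Proof.
move=> h1 h2 j; have := h1 j; have := h2 j; case: ifP => _ e2 e1.
  exact: gr_compB.
by rewrite prodmodDE prodmodNE e1 e2 subr0.
Qed.

Lemma in_spotD q r d z1 z2 :
  in_spot q r d z1 -> in_spot q r d z2 -> in_spot q r d (z1 + z2).
Proof.
move=> h1 h2 j; have := h1 j; have := h2 j; case: ifP => _ e2 e1.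
  exact: gr_compD.
by rewrite prodmodDE e1 e2 addr0.
Qed.

Lemma in_spotZ q r c d p z :
  homogz c p -> in_spot q r d z -> in_spot q r (c + d) (p *: z).
Proof.
move=> hp hz j; have := hz j; case: ifP => _; first exact: gr_comp_homogz.
by rewrite prodmodZE => ->; rewrite scaler0.
Qed.

Lemma in_spot_raise q r d z : in_spot q r d z -> in_spot q r.+1 d (E z).
Proof.
move=> hz [|j] /=; first by case: ifP => // _; exact: gr_comp0.
rewrite addnS eqSS; have := hz j; case: ifP => _; first exact: inj_diff_degree0.
by move=> ->; exact: linear0.
Qed.

Lemma lower_lower v : D (D v) = 0.
Proof.
by apply: product_moduleP => i; apply/free_exactS; exists (v i.+2).
Qed.

Lemma raise_raise z : E (E z) = 0.
Proof.
apply: product_moduleP => -[|[|j]] //=; first exact: linear0.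
by apply/inj_exactS; exists (z j).
Qed.

Lemma bco_lower v b :
  bco (D v) b = \sum_(b' | bpos b' == (bpos b).+1) bco v b' * bco (D (bel b'))
    b.
Proof.
rewrite {1}[v]bcoE linear_sum (co_sum bcoP) [RHS]big_mkcond.
apply: eq_bigr => b' _; rewrite linearZZ (coZ bcoP); case: eqP => // neq.
rewrite [X in _ * X](_ : _ = 0) ?mulr0 // /bco /= /lower /bel single_out.
  by rewrite linear0 basis_coord0 mxE.
exact/eqP.
Qed.

Lemma bco_lower_bel b b' : bco (D (bel b')) b != 0 ->
  bpos b' = (bpos b).+1.
Proof.
rewrite bco_lower; case: (eqVneq (bpos b') (bpos b).+1) => // neq.
rewrite big1 ?eqxx // => c /eqP cb; rewrite bco_bel; case: eqP => [bc|].
  by rewrite bc cb eqxx in neq.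
by rewrite mul0r.
Qed.

Lemma bco_lower_homogz b b' :
  homogz (bdeg b' - bdeg b) (bco (D (bel b')) b).
Proof.
have [e|/bco_lower_bel bb'] := eqVneq (bco (D (bel b')) b) 0.
  by rewrite e => m; rewrite msupp0.
apply: basis_coord_homogz; apply: free_diff_degree0.
rewrite /bel; case: b' bb' => i' j' /=; rewrite /bpos /= => <-.
by rewrite single_in; apply: basis_homog.
Qed.

(** This is minimality of the resolution: [power_ideal 1 n] is the ideal (x_1, ..., x_n). *)
Lemma bco_lower_irrelevant v b : power_ideal 1 n (bco (D v) b).
Proof.
have [w wE] := @free_minimal _ _ _ _ F (bpos b) (v (bpos b).+1).
pose co (u : free_term F (bpos b)) j :=
  basis_coord (free_basis F (bpos b)) u 0 j.
have coP a u1 u2 j : co (a *: u1 + u2) j = a * co u1 j + co u2 j.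
  by rewrite /co basis_coordP !mxE.
suff H : coord_in co (power_ideal 1 n) (D v (bpos b)) by exact: H.
rewrite /lower wE.
apply: (submod_sum (coord_in_submodule coP (power_ideal_submodule k n 1 n))).
move=> i _ j; rewrite (coZ coP) mulrC; apply: power_idealM; apply: power_idealX.
by apply/existsP; exists i; rewrite ltn_ord mnm1E eqxx.
Qed.

Lemma ann_coord (J : S -> Prop) z : ann J z <-> forall j, ann J (z j).
Proof.
split=> [Jz j p /Jz pz|Jz p Jp]; last by apply: product_moduleP => j; apply: Jz.
exact: (congr1 (fun u : W => u j) pz).
Qed.

Lemma ann_raise (J : S -> Prop) z : ann J z -> ann J (E z).
Proof. by move=> Jz p Jp; rewrite -linearZZ Jz // linear0. Qed.

Lemma product_coregular e r (lt_rn : (r < n)%N) z :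
  ann (power_ideal e r) z ->
  exists y : W, ann (power_ideal e r) y /\ 'X_(Ordinal lt_rn) ^+ e *: y = z.
Proof.
move=> /ann_coord Jz.
have lift j := injective_coregular (@inj_injective _ _ _ I j) lt_rn (Jz j).
exists (fun j => projT1 (cid (lift j))); split.
  by apply/ann_coord => j; case: cid => ? /= [].
by apply: product_moduleP => j; rewrite prodmodZE; case: cid => ? /= [].
Qed.

Lemma product_graded_coregular e r (lt_rn : (r < n)%N) q r' d z :
  in_spot q r' d z -> ann (power_ideal e r) z ->
  exists y : W, [/\ ann (power_ideal e r) y, in_spot q r' (d - e%:Z) y
                  & 'X_(Ordinal lt_rn) ^+ e *: y = z].
Proof.
move=> hz /ann_coord Jz.
have lift j : exists y : inj_term I j, [/\ ann (power_ideal e r) y,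
    if (q + j == r')%N then gr_comp (d - e%:Z) y else y = 0
    & 'X_(Ordinal lt_rn) ^+ e *: y = z j].
  have := hz j; case: ifP => _ hzj.
    apply: graded_injective_coregular hzj (Jz j); exact: inj_injective.
  exists 0; rewrite scaler0; split=> //.
  exact: (submod0 (ann_submodule _ _)).
exists (fun j => projT1 (cid (lift j))); split.
- by apply/ann_coord => j; case: cid => ? /= [].
- by move=> j; case: cid => ? /= [].
- by apply: product_moduleP => j; rewrite prodmodZE; case: cid => ? /= [].
Qed.

(** Each of the r connecting maps lowers the degree by e and contributes one sign. *)
Definition comparison e r (phi : {linear V -> W}) := [/\
  forall v, ann (power_ideal e r) (phi v),
  forall v, E (phi v) = (-1) ^+ r *: phi (D v),
  forall b, in_spot (bpos b) r (bdeg b - (r * e)%:Z) (phi (bel b))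
  & homology_bij D E (coord_in bco (power_ideal e r)) (ann (power_ideal e r))
    phi].

Definition augmentation_map v : W :=
  prodmod_single (T := fun j => inj_term I j : lmodType S)
    (inj_coaug I (free_aug F (v 0%N))).

Lemma augmentation_map_is_linear : linear augmentation_map.
Proof.
by move=> a u v;
  rewrite /augmentation_map -linearP prodmodDE prodmodZE !linearP.
Qed.

HB.instance Definition _ :=
  GRing.isLinear.Build S V W _ augmentation_map augmentation_map_is_linear.

(** Without variables the ideal is zero, and both complexes are resolutions of M, joined by F_0 -> M
    -> I^0. *)
Lemma comparison0 e : comparison e 0 augmentation_map.
Proof.
have J0 (U : lmodType S) (u : U) : ann (power_ideal e 0) u.
  by move=> p /power_ideal_n0 ->; rewrite scale0r.
have co0P v : coord_in bco (power_ideal e 0) v -> v = 0.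
  move=> Jv; rewrite [v]bcoE big1 // => b _.
  by rewrite (power_ideal_n0 (Jv b)) scale0r.
have inj_d_coaug m : inj_diff I 0 (inj_coaug I m) = 0.
  by apply/inj_exact0; exists m.
have aug_d u : free_aug F (free_diff F 0 u) = 0.
  by apply/free_exact0; exists u.
split=> //.
- move=> v; rewrite expr0 scale1r /= /augmentation_map /lower aug_d !linear0.
  apply: product_moduleP => -[|j] //=; rewrite /prodmod_single.
  case: j => [|j]; first by rewrite dfwith_in.
  by rewrite dfwith_out // linear0.
- move=> b; rewrite mul0n subr0 => -[|j] /=.
    rewrite addn0; have [b0|b0] := eqVneq (bpos b) 0%N.
      rewrite /= /augmentation_map single_in; apply: inj_coaug_degree0.
      apply: free_aug_degree0; rewrite /bel; case: b b0 => i j /=.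
      by rewrite /bpos /= => <-; rewrite single_in; apply: basis_homog.
    rewrite /= /augmentation_map single_in /bel single_out //.
    by rewrite !linear0.
  by rewrite addnS /augmentation_map single_out.
- split=> [v y /co0P Dv _ phiE|z _ Ez].
    (* Position 0 of [E y] is zero by the definition of [raise], so v is killed by the augmentation
       in position 0. Exactness of F then gives preimages everywhere. *)
    have v0 : free_aug F (v 0%N) = 0.
      apply: (@inj_coaug_inj _ _ _ I); rewrite linear0.
      have := congr1 (fun z : W => z 0%N) phiE.
      by rewrite /= /augmentation_map single_in.
    have lift i : exists w, free_diff F i w = v i.
      case: i => [|i]; first exact/free_exact0.
      apply/free_exactS.
      exact: (congr1 (fun u : V => u i) Dv).
    exists (fun i => if i is i'.+1 then projT1 (cid (lift i')) else 0), 0;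
      split.
      exact: (submod0 (coord_in_submodule bcoP (power_ideal_submodule k n e
        0))).
    rewrite addr0; apply: product_moduleP => i.
    by rewrite /= /lower; case: cid.
  have [m mE] : exists m, inj_coaug I m = z 0%N.
    by apply/inj_exact0; have := congr1 (fun u : W => u 1%N) Ez.
  have [w wE] := @free_aug_surj _ _ _ _ F m.
  have lift j : exists y, inj_diff I j y = z j.+1.
    by apply/inj_exactS; have := congr1 (fun u : W => u j.+2) Ez.
  exists (prodmod_single (T := fun i => free_term F i : lmodType S) w).
  exists (fun j => projT1 (cid (lift j))); split=> //.
    move=> b m' _; rewrite [X in X@_m'](_ : _ = 0) ?mcoeff0 // -(co0 bcoP b).
    congr (bco _ b); apply: product_moduleP => i.
    by rewrite /= /lower single_out // linear0.
  apply: product_moduleP => -[|j]; rewrite prodmodDE /= /augmentation_map.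
    by rewrite !single_in addr0 wE mE.
  by rewrite single_out // add0r; case: cid.
Qed.

Lemma sign_sqr r : ((-1) ^+ r : S) * (-1) ^+ r = 1.
Proof. by rewrite -exprMn mulrNN mul1r expr1n. Qed.

(** The next map is the connecting map of a lift [w] of [phi] through x_(r+1)^e. The lift is
    returned too, because homotopies are built from it. *)
Lemma comparison_step e r (lt_rn : (r < n)%N) (phi : {linear V -> W}) :
  comparison e r phi ->
  exists w : {linear V -> W}, [/\ forall v, ann (power_ideal e r) (w v),
    forall v, 'X_(Ordinal lt_rn) ^+ e *: w v = phi v
    & comparison e r.+1 (connecting_map D E ((-1) ^+ r) w)].
Proof.
move=> [phiW Ephi phi_spot phi_bij].
have [|w [wW w_spot xw]] := @linear_lift _ _ _ _ bel bco bcoP bcoE bco_bel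
  (power_ideal e r) ('X_(Ordinal lt_rn) ^+ e) phi
  (fun b z => in_spot (bpos b) r (bdeg b - (r * e)%:Z - e%:Z) z).
  by move=> b; exact: product_graded_coregular (phi_spot b) (phiW _).
exists w; split=> //.
have subI := power_ideal_submodule k n e r.
have subV := coord_in_submodule bcoP subI.
have subW := ann_submodule W (power_ideal e r).
have coregP := product_coregular lt_rn (e := e).
have xpsi v : 'X_(Ordinal lt_rn) ^+ e *: connecting_map D E ((-1) ^+ r) w v = 0.
  rewrite /connecting_map scalerBr -(linearZZ E) xw /= Ephi scalerA mulrC
    -scalerA xw.
  by rewrite subrr.
have psiW v : ann (power_ideal e r) (connecting_map D E ((-1) ^+ r) w v).
  by apply: (submodB subW); [exact: ann_raise | exact: (submodZ subW)].
split.
- by move=> v; apply/(ann_power_idealS e lt_rn); split;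
    [exact: psiW | exact: xpsi].
- move=> v; rewrite exprS mulN1r; apply: connecting_map_anticomm.
    exact: lower_lower.
  exact: raise_raise.
- move=> b.
  have -> : bdeg b - (r.+1 * e)%:Z = bdeg b - (r * e)%:Z - e%:Z.
    by rewrite mulSn PoszD; ring.
  apply: in_spotB; first exact: in_spot_raise.
  have sign_homogz : homogz 0 ((-1) ^+ r : S).
    rewrite -mpolyC1 -mpolyCN -rmorphXn => m.
    by rewrite msuppC; case: ifP => // _; rewrite inE => /eqP ->; rewrite mdeg0.
  rewrite -[X in in_spot _ _ X]add0r; apply: in_spotZ sign_homogz _.
  (* D (bel b) is expanded in generators b' one position lower. The degrees of the coefficients make
     up for the difference of the generator degrees. *)
  rewrite /= [lower _ _]bcoE linear_sum.
  apply: (big_ind (in_spot (bpos b) r.+1 _)).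
  + exact: in_spot0.
  + exact: in_spotD.
  move=> b' _; rewrite (linearZZ w).
  have [->|/bco_lower_bel bb'] := eqVneq (bco (D (bel b)) b') 0.
    by rewrite scale0r; exact: in_spot0.
  have := in_spotZ (@bco_lower_homogz b' b) (w_spot b').
  rewrite (_ : bdeg b - bdeg b' + (bdeg b' - (r * e)%:Z - e%:Z) =
    bdeg b - (r * e)%:Z - e%:Z); last by ring.
  by move=> h j; have := h j; rewrite bb' addSn eqSS.
- apply: (@connecting_map_homology_bij _ _ _ _ _ _ _ ('X_(Ordinal lt_rn) ^+ e) _
    (coord_in bco (power_ideal e r)) _ (ann (power_ideal e r)) _ phi w _ subV
      subW) => //.
  + exact: lower_lower.
  + exact: raise_raise.
  + exact: sign_sqr.
  + by move=> v; exact: (coord_in_linear bcoP bcoE).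
  + by move=> z; exact: ann_raise.
  + by move=> v; exact: (coord_in_power_idealS e lt_rn v bcoP bcoE bco_bel).
  + by move=> z; exact: ann_power_idealS.
  + move=> v Jv b; apply: (power_ideal_regular (lt_rn := lt_rn)).
    by rewrite -(coZ bcoP).
  + by move=> v; exact: (linear_coord_in bcoE).
  + by move=> v; exact: (linear_coord_in bcoE).
Qed.

(* The multiples by (x_1 ... x_r)^e correspond to the map
   S/(x_1, ..., x_r) -> S/(x_1^(e+1), ..., x_r^(e+1)), and the comparison map of
   exponent 1 is homotopic to that of exponent e+1 precomposed with it. *)
Lemma comparison_homotopy r : (r <= n)%N ->
  exists phi : {linear V -> W}, comparison 1 r phi /\
  forall e, exists phi' h : {linear V -> W}, [/\ comparison e.+1 r phi',
    forall v, ann (power_ideal 1 r) (h v)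
    & forall v, phi v - 'X_[power_mnm n e r] *: phi' v =
        E (h v) + (-1) ^+ r *: h (D v)].
Proof.
elim: r => [_|r IHr lt_rn].
  exists augmentation_map; split=> [|e]; first exact: comparison0.
  exists augmentation_map, (\0 : {linear V -> W}); split=> [|v p _|v].
  - exact: comparison0.
  - by rewrite scaler0.
  - rewrite (_ : power_mnm n e 0 = 0%MM) ?mpolyX0 ?scale1r; last first.
      by apply/mnmP => i; rewrite [RHS]mnm0E mnmE.
    by rewrite /= subrr linear0 addr0.
have [phi [phiP IH]] := IHr (ltnW lt_rn).
have [w [wW xw wP]] := comparison_step lt_rn phiP.
eexists; split; first exact: wP.
move=> e; have [phi' [h [phiP' hW hE]]] := IH e.
have [w' [wW' xw' wP']] := comparison_step lt_rn phiP'.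
set s_ := (-1) ^+ r : S; set x : S := 'X_(Ordinal lt_rn).
set y : S := 'X_[power_mnm n e r].
have yE : 'X_[power_mnm n e r.+1] = x ^+ e * y by exact: power_mnmS.
have [|l [lW _ xl]] := @linear_lift _ _ _ _ bel bco bcoP bcoE bco_bel
  (power_ideal 1 r) (x ^+ 1) h (fun _ _ => True).
  move=> b; have [z [Jz zE]] := product_coregular lt_rn (hW (bel b)).
  by exists z.
pose El : {linear V -> W} := (E : {linear W -> W}) \o l.
pose lD : {linear V -> W} := l \o (D : {linear V -> V}).
(* The difference w - x^e y w' already satisfies the homotopy equation, but x times it is E h + s h
   D. Subtracting E l + s l D, where x l = h, makes it killed by x and leaves the equation
   intact. *)
pose u : {linear V -> W} := w \- (x ^+ e * y) \*: w' \- El \- s_ \*: lD.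
eexists; exists u; split; first exact: wP'.
- have subW := ann_submodule W (power_ideal 1 r).
  move=> v; apply/(ann_power_idealS 1 lt_rn); split.
    apply: (submodB subW); last by apply: (submodZ subW); exact: lW.
    apply: (submodB subW); last by apply: ann_raise; exact: lW.
    apply: (submodB subW); first exact: wW.
    (* Multiplication by y carries (x_1, ..., x_r) into (x_1^(e+1), ..., x_r^(e+1)), which kills the
       values of w'. *)
    move=> p Jp; rewrite /= scalerA mulrC -mulrA -scalerA.
    by rewrite (wW' _ _ (@power_ideal_power_mnm k n e r p Jp)) scaler0.
  have xw'y : x ^+ 1 *: ((x ^+ e * y) *: w' v) = y *: phi' v.
    by rewrite -xw' !scalerA -/x expr1 mulrA -exprS [y * _]mulrC.
  have := hE v; rewrite /= /u /El /lD /= !scalerBr xw -/x xw'y => ->.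
  rewrite -(linearZZ E) xl scalerA [_ * s_]mulrC -scalerA xl.
  by rewrite -addrA -opprD subrr.
- move=> v; rewrite yE exprS mulN1r /= /connecting_map /u /El /lD /=.
  rewrite !(linearB E) !(linearZZ E) /= raise_raise lower_lower (linear0 l).
  rewrite scaleNr -/s_ scaler0 !subr0 !scalerBr !scalerA [s_ * _]mulrC.
  set a := raise _ (w v); set m := s_ *: raise _ _; set b := s_ *: w _.
  rewrite [in RHS]opprB addrA subrK opprB [_ *: _ - _ in LHS]addrC addrACA.
  by rewrite opprB [- b + _]addrC.
Qed.

(** * Local cohomology classes and generators *)

Lemma raise_single j (y : inj_term I j) :
  E (prodmod_single (T := fun j => inj_term I j : lmodType S) y) =
  prodmod_single (T := fun j => inj_term I j : lmodType S) (inj_diff I j y).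
Proof.
apply: product_moduleP => -[|i]; rewrite /raise; first by rewrite single_out.
have [<-|ji] := eqVneq j i; first by rewrite !single_in.
by rewrite !single_out // linear0.
Qed.

Lemma ann_single (J : S -> Prop) j (y : inj_term I j) :
  ann J y -> ann J (prodmod_single (T := fun j => inj_term I j : lmodType S) y).
Proof. by move=> Jy p Jp; rewrite -linearZZ Jy // linear0. Qed.

Lemma lc_coboundary_raise j d (z : inj_term I j) : lc_coboundary d z ->
  exists e (y : W), ann (power_ideal e.+1 n) y /\
    prodmod_single (T := fun j => inj_term I j : lmodType S) z = E y.
Proof.
case: j z => [|j] z /=.
  move=> ->; exists 0%N, 0; split; first exact: (submod0 (ann_submodule _ _)).
  by rewrite !linear0.
move=> [y [_ ty <-]]; have [e Jy] := in_torsion_ann ty.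
by exists e, (prodmod_single (T := fun j => inj_term I j : lmodType S) y);
  split; [exact: ann_single | rewrite raise_single].
Qed.

(** A cocycle has the form phi(v) + E y. If all generators in position n - j have degree below d +
    n, then phi(v) has no part of degree d in position j, and the part of y of degree d shows that
    the cocycle is a coboundary. *)
Lemma lc_neq0_generator j d : local_cohomology_neq0 I j d ->
  exists b, (bpos b + j)%N = n /\ d + n%:Z <= bdeg b.
Proof.
move=> [z [[hz tz dz] not_cob]]; apply: contrapT => no_b; apply: not_cob.
have [e Jz] := in_torsion_ann tz.
have [_ [_ /(_ e) [phi [_ [phiP _ _]]]]] := comparison_homotopy (leqnn n).
have [phiW _ phi_spot [_ surj]] := phiP.
have [|v [y [_ /ann_coord Jy zE]]] := surj _ (ann_single Jz).
  by rewrite /= raise_single dz linear0.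
have phi_off : off_degree d (phi v j).
  rewrite [v]bcoE linear_sum prodmod_sumE.
  apply: (big_ind (off_degree d)).
  - exact: off_degree0.
  - exact: off_degreeD.
  move=> b _; rewrite linearZZ prodmodZE.
  have := phi_spot b j; case: eqP => [bj hb|_ ->]; last first.
    by rewrite scaler0; exact: off_degree0.
  (* A monomial leading to degree d has degree d + n (e+1) - bdeg b. This exceeds n e when bdeg b <
     d + n, so the monomial lies in the ideal that kills phi. *)
  apply: off_degree_scale hb => m _ mE.
  have /ann_coord Jphi := phiW (bel b); apply: Jphi; apply: power_idealX.
  apply: mdeg_in_power_mnm; rewrite ltnNge; apply/negP => le_m.
  apply: no_b; exists b; split=> //; lia.
have {}zE : z = phi v j + E y j.
  have := congr1 (fun u : W => u j) zE.
  by rewrite /= single_in.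
case: j => [|j] in z hz tz dz Jz zE phi_off surj no_b *.
  apply: off_degree_eq0 hz _; rewrite zE.
  by rewrite /= addr0.
have [u [hu Ju off_u]] := ann_component d (Jy j).
exists u; split=> //; first exact: ann_in_torsion Ju.
apply/esym/eqP; rewrite -subr_eq0; apply/eqP.
apply: (@off_degree_eq0 _ _ _ d).
  by apply: gr_compB => //; exact: inj_diff_degree0.
rewrite zE /= -addrA -linearB; apply: off_degreeD => //.
exact: off_degree_map (@inj_diff_degree0 _ _ _ I j) off_u.
Qed.

(** The class is phi(bel b) for the comparison map of exponent 1, whence the degree bdeg b - n. The
    homotopies identify it with the images of the socle elements for all exponents, so it becomes a
    boundary at no stage of the torsion. *)
Lemma generator_lc_neq0 b :
  (forall b', bpos b' = (bpos b).+1 -> bdeg b' <= bdeg b) ->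
  (bpos b <= n)%N /\ local_cohomology_neq0 I (n - bpos b) (bdeg b - n%:Z).
Proof.
move=> top_b.
(* By minimality a nonzero coefficient would contain monomials of positive degree only, whereas
   [top_b] makes its degree at most 0. *)
have no_coeff v : bco (D v) b = 0.
  rewrite bco_lower big1 // => b' /eqP bb'.
  rewrite [X in _ * X](_ : _ = 0) ?mulr0 //; apply/mpolyP => m.
  rewrite mcoeff0; apply: memN_msupp_eq0; apply/negP => mb.
  have mE := bco_lower_homogz mb.
  have /existsP [i /andP [_ mi]] :=
    power_ideal_msupp (bco_lower_irrelevant _ _) mb.
  have := top_b _ bb'; have : (0 < mdeg m)%N.
    by rewrite mdegE (bigD1 i) //= ltn_addr.
  lia.
have [phi [phiP homot]] := comparison_homotopy (leqnn n).
have [phiW Ephi phi_spot _] := phiP.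
have not_boundary e y : ann (power_ideal e.+1 n) y -> phi (bel b) <> E y.
  move=> Jy phiE; have [phi' [h [[_ _ _ [inj _]] hW hE]]] := homot e.
  set a : S := 'X_[power_mnm n e n] in hE.
  (* The coordinates of D (bel b) lie in (x_1, ..., x_n), which kills the values of h. *)
  have hD : h (D (bel b)) = 0.
    by apply: (linear_coord_in bcoE hW) => b'; exact: bco_lower_irrelevant.
  have phi'E : phi' (a *: bel b) = E (y - h (bel b)).
    have := hE (bel b); rewrite hD scaler0 addr0 phiE => /eqP.
    rewrite subr_eq addrC -subr_eq => /eqP e1.
    by rewrite linearZZ -e1 linearB.
  have [||g [q [Jq aE]]] := inj _ _ _ _ phi'E.
  - move=> b'; rewrite linearZZ (coZ bcoP).
    by apply: power_ideal_power_mnm; exact: bco_lower_irrelevant.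
  - apply: (submodB (ann_submodule _ _)) => // p Jp; apply: hW.
    exact: power_ideal_leq Jp.
  (* In [aE] the boundary D g has no coefficient at b, so the socle monomial itself would lie in the
     ideal. *)
  apply: (@power_mnm_notin k n e); have := Jq b.
  have := congr1 (fun v => bco v b) aE.
  by rewrite (coZ bcoP) bco_bel eqxx mulr1 (coD bcoP) no_coeff add0r => <-.
have ann0 e : ann (power_ideal e n) (0 : W).
  exact: (submod0 (ann_submodule _ _)).
have phi_neq0 : phi (bel b) <> 0.
  by move=> e; apply: (not_boundary 0%N 0 (ann0 _)); rewrite linear0.
(* A generator beyond position n has no position to be mapped to, so its image would be zero. *)
have le_bn : (bpos b <= n)%N.
  rewrite leqNgt; apply/negP => lt_nb; apply: phi_neq0.
  apply: product_moduleP => j; have := phi_spot b j; case: eqP => // e.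
  by exfalso; lia.
split=> //; pose j := (n - bpos b)%N.
have phi_out i : i != j -> phi (bel b) i = 0.
  by move=> ij; have := phi_spot b i; case: eqP => // e; case/eqP: ij; lia.
have Jphi : ann (power_ideal 1 n) (phi (bel b) j).
  by have /ann_coord := phiW (bel b); apply.
exists (phi (bel b) j); split; first split.
- have := phi_spot b j; rewrite muln1 /j subnKC // eqxx; exact.
- exact: ann_in_torsion Jphi.
- have := congr1 (fun z : W => z j.+1) (Ephi (bel b)); rewrite /= => ->.
  rewrite (linear_coord_in bcoE phiW) ?scaler0 // => b'.
  exact: bco_lower_irrelevant.
- move=> /lc_coboundary_raise [e [y [Jy yE]]]; apply: (not_boundary e y Jy).
  rewrite -yE; apply: product_moduleP => i; have [<-|ji] := eqVneq j i.
    by rewrite single_in.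
  by rewrite single_out // phi_out // eq_sym.
Qed.

End Comparison.

(** * Degree bounds *)

Lemma zmax_ge (P : int -> Prop) m : P m -> (m%:E <= zmax P)%E.
Proof.
rewrite /zmax => Pm; case: pselect => [e|_].
  by case: cid => m' /= [_ le_m']; rewrite lee_fin le_m'.
by case: asboolP => [_|no_m]; [exact: leey | case: no_m; exists m].
Qed.

Lemma int_max_exists (P : int -> Prop) m r :
  P m -> (forall j, P j -> j <= r) -> exists i, P i /\ forall j, P j -> j <= i.
Proof.
move=> Pm le_r; have [N] : exists N : nat, r - m <= N%:Z.
  by exists `|r - m|%N; lia.
elim: N m Pm => [|N IHN] m Pm le_N.
  by exists m; split=> // j /le_r; lia.
case: (pselect (exists2 j, P j & m < j)) => [[j Pj mj]|no_j].
  by apply: IHN Pj _; lia.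
exists m; split=> // j Pj; rewrite leNgt; apply/negP => mj.
by apply: no_j; exists j.
Qed.

(** The value +oo is the delicate case: a nonempty set of integers with a finite upper bound has a
    maximum. *)
Lemma zmax_le (P : int -> Prop) (c : \bar int) :
  (forall m, P m -> (m%:E <= c)%E) -> (zmax P <= c)%E.
Proof.
move=> le_c; rewrite /zmax; case: pselect => [e|no_max].
  by case: cid => m /= [Pm _]; apply: le_c.
case: asboolP => [[m Pm]|_]; last exact: leNye.
case: c le_c => [r||] // le_c; last by have := le_c m Pm.
case: no_max; apply: (int_max_exists (r := r) Pm) => j /le_c.
by rewrite lee_fin.
Qed.

Section Bounds.
Variables (k : fieldType) (n : nat) (M : gradedModule k n) (s : nat).
Variables (F : minimal_free_resolution M s) (I : injective_resolution M).
Local Notation B := {i : 'I_s.+1 & 'I_(basis_rank (free_basis F i))}.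

Lemma max_gen_degree_ge (b : B) :
  ((bdeg b)%:E <= max_gen_degree F (bpos b))%E.
Proof. by apply: zmax_ge; exists (tagged b). Qed.

Lemma max_gen_degree_le i (c : \bar int) : (i < s.+1)%N ->
  (forall b : B,
     bpos b = i -> ((bdeg b)%:E <= c)%E) ->
  (max_gen_degree F i <= c)%E.
Proof.
move=> lt_is le_c; apply: zmax_le => m [j <-].
pose b : B := Tagged (fun i : 'I_s.+1 => 'I_(basis_rank (free_basis F i)))
    (i := Ordinal lt_is) j.
exact: (le_c b).
Qed.

(* If F_(i+1) has a generator of degree larger than that of b, it gives a bound
   at least as good; otherwise b itself gives a local cohomology class. *)
Lemma generator_le t (c : nat -> int) (T : \bar int)
    (b : B) :
  (forall j, c j.+1 <= c j + 1) ->
  (forall j m, (j <= t)%N -> local_cohomology_neq0 I j m ->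
    ((m + c j)%:E <= T)%E) ->
  (n - t <= bpos b)%N ->
  ((bdeg b - n%:Z + c (n - bpos b)%N)%:E <= T)%E.
Proof.
(* Induction on the distance of b from the end of the resolution. *)
move=> c_step lc_T; have [N] : exists N, (s.+1 - bpos b <= N)%N by eexists.
elim: N b => [|N IHN] b le_N le_t.
  have : (bpos b < s.+1)%N by exact: ltn_ord.
  lia.
have [[b' bb' lt_b]|no_b'] :=
    pselect (exists2 b' : B, bpos b' = (bpos b).+1 & bdeg b < bdeg b').
  apply: le_trans (IHN b' _ _); [rewrite lee_fin bb' | lia | lia].
  (* From position n on both truncated differences are 0 and the larger degree suffices. Before n,
     [c] drops by at most 1 and the degree grows by at least 1. *)
  case: (ltnP (bpos b) n) => lt_bn; last first.
    have -> : (n - bpos b = 0)%N by lia.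
    have -> : (n - (bpos b).+1 = 0)%N by lia.
    lia.
  have := c_step (n - (bpos b).+1)%N; rewrite subnSK //.
  lia.
have top_b (b' : B) : bpos b' = (bpos b).+1 -> bdeg b' <= bdeg b.
  move=> bb'; rewrite leNgt; apply/negP => lt_b.
  by apply: no_b'; exists b'.
have [le_bn lc_b] := generator_lc_neq0 I top_b.
by apply: lc_T lc_b; lia.
Qed.

End Bounds.

(* The bound i < s.+1 loses nothing: max_gen_degree F i = -oo for i > s. *)
Theorem theorem3p1 (k : fieldType) (n : nat) (M : gradedModule k n)
    (fgM : finitely_generated M)
    (s : nat) (F : minimal_free_resolution M s)
    (I : injective_resolution M)
    (t : nat) (ht : (t%:Z%:E <= krull_dim M)%E) :
  (reg_upto I t =
     \big[maxe/-oo]_((n - t)%N <= i < s.+1) (max_gen_degree F i - i%:Z%:E))%E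
  /\
  (astar_upto I t =
     (\big[maxe/-oo]_((n - t)%N <= i < s.+1) max_gen_degree F i) - n%:Z%:E)%E.
Proof.
have in_range (b : {i : 'I_s.+1 & 'I_(basis_rank (free_basis F i))}) j :
    (j < t.+1)%N -> (bpos b + j)%N = n -> bpos b \in index_iota (n - t) s.+1.
  by move=> jt bj; rewrite mem_index_iota ltn_ord andbT; lia.
have reg_ge j m : (j <= t)%N -> local_cohomology_neq0 I j m ->
    ((m + j%:Z)%:E <= reg_upto I t)%E.
  move=> jt lc; rewrite /reg_upto.
  apply: le_trans (le_bigmax_cond -oo%E (j := Ordinal (jt : j < t.+1)%N)
    (fun i : 'I_t.+1 => a_inv I i + i%:Z%:E)%E isT).
  by rewrite EFinD leeD2r // zmax_ge.
have astar_ge j m : (j <= t)%N -> local_cohomology_neq0 I j m ->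
    ((m + 0)%:E <= astar_upto I t)%E.
  move=> jt lc; rewrite /astar_upto addr0.
  apply: le_trans (le_bigmax_cond -oo%E (j := Ordinal (jt : j < t.+1)%N)
    (fun i : 'I_t.+1 => a_inv I i) isT).
  by rewrite zmax_ge.
split; apply/le_anti/andP; split.
- apply: bigmax_le => [|j _]; first exact: leNye.
  rewrite -leeBrDr //; apply: zmax_le => m.
  move=> /(lc_neq0_generator F) [b [bj le_b]]; rewrite leeBrDr //.
  apply: le_trans (le_bigmax_seq -oo%E (bpos b) xpredT _
    (in_range b j (ltn_ord j) bj) isT).
  apply: (@le_trans _ _ (bdeg b - (bpos b)%:Z)%:E).
    by rewrite -EFinD lee_fin; lia.
  by rewrite EFinB leeB // max_gen_degree_ge.
- rewrite big_seq; apply: bigmax_le => [|i]; first exact: leNye.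
  rewrite mem_index_iota => /andP [ti lt_is].
  rewrite leeBlDr //; apply: max_gen_degree_le => // b bi.
  rewrite -leeBlDr // -EFinB.
  (* The weight c j = j yields the regularity. For i > n the truncated n - i is 0, and bdeg b - i <=
     bdeg b - n is enough. *)
  have step j : j.+1%:Z <= j%:Z + 1 by lia.
  have := generator_le (b := b) step reg_ge; rewrite bi => /(_ ti).
  by apply: le_trans; rewrite lee_fin; lia.
- apply: bigmax_le => [|j _]; first exact: leNye.
  apply: zmax_le => m /(lc_neq0_generator F) [b [bj le_b]]; rewrite leeBrDr //.
  apply: le_trans (le_bigmax_seq -oo%E (bpos b) xpredT _
    (in_range b j (ltn_ord j) bj) isT).
  by apply: le_trans (max_gen_degree_ge b); rewrite -EFinD lee_fin.
- rewrite leeBlDr // big_seq; apply: bigmax_le => [|i]; first exact: leNye.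
  rewrite mem_index_iota => /andP [ti lt_is].
  apply: max_gen_degree_le => // b bi.
  rewrite -leeBlDr // -EFinB.
  (* The same bound with weight 0 yields the invariant a*. *)
  have := generator_le (b := b) (c := fun=> 0) (fun=> ler01) astar_ge.
  by rewrite bi addr0; apply.
Qed.
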